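(* Every finitely generated group embeds quasi-isometrically (with respect to word metrics from finite generating sets) as a subgroup of a simple group that can be generated by two elements.
   Context: A group is simple if it is nontrivial and has no normal subgroups other than itself and the trivial subgroup. An injective homomorphism $H\to K$ of finitely generated groups is a quasi-isometric embedding if there are $C,D>0$ with $\frac1C d(x,y)-D\le d(f(x),f(y))\le C d(x,y)+D$ for the word metrics. *)

(* Defs.v *)
From Stdlib Require Import Reals List.
Export ListNotations.
Open Scope R_scope.

Record Group := {
  carrier :> Type;
  gmul : carrier -> carrier -> carrier;
  gone : carrier;
  ginv : carrier -> carrier;
  gmul_assoc : forall x y z, gmul x (gmul y z) = gmul (gmul x y) z;
  gmul_one_l : forall x, gmul gone x = x;
  gmul_one_r : forall x, gmul x gone = x;
  gmul_inv_l : forall x, gmul (ginv x) x = gone;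
  gmul_inv_r : forall x, gmul x (ginv x) = gone
}.

Arguments gmul {g}.
Arguments gone {g}.
Arguments ginv {g}.

Definition letter_val {G : Group} (l : bool * G) : G :=
  if fst l then snd l else ginv (snd l).

Fixpoint word_eval {G : Group} (w : list (bool * G)) : G :=
  match w with
  | [] => gone
  | l :: w' => gmul (letter_val l) (word_eval w')
  end.

Definition word_over {G : Group} (S : list G) (w : list (bool * G)) : Prop :=
  forall l, In l w -> In (snd l) S.

Definition generates {G : Group} (S : list G) : Prop :=
  forall g : G, exists w, word_over S w /\ word_eval w = g.

Definition finitely_generated (G : Group) : Prop :=
  exists S : list G, generates S.

Definition word_dist {G : Group} (S : list G) (x y : G) (n : nat) : Prop :=
  (exists w, word_over S w /\ word_eval w = gmul (ginv x) y /\ length w = n) /\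
  (forall w, word_over S w -> word_eval w = gmul (ginv x) y -> (n <= length w)%nat).

Definition is_hom {G K : Group} (f : G -> K) : Prop :=
  forall x y, f (gmul x y) = gmul (f x) (f y).

Definition injective {A B : Type} (f : A -> B) : Prop :=
  forall x y, f x = f y -> x = y.

Definition qi_embedding {G K : Group} (S : list G) (T : list K) (f : G -> K) : Prop :=
  exists C D : R, 0 < C /\ 0 < D /\
    forall (x y : G) (m n : nat), word_dist S x y m -> word_dist T (f x) (f y) n ->
      / C * INR m - D <= INR n /\ INR n <= C * INR m + D.

Definition normal_subgroup {G : Group} (N : G -> Prop) : Prop :=
  N gone /\
  (forall x y, N x -> N y -> N (gmul x y)) /\
  (forall x, N x -> N (ginv x)) /\
  (forall g x, N x -> N (gmul (gmul (ginv g) x) g)).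

Definition simple_group (G : Group) : Prop :=
  (exists g : G, g <> gone) /\
  forall N : G -> Prop, normal_subgroup N ->
    (forall x, N x <-> x = gone) \/ (forall x, N x).

(* Main.v *)
(** Let Q = G x Z act on configurations y : Q -> bool by translation, and let
    X be the set of triples (letter, infinite binary word, configuration).
    Prefix replacement on the first two components, possibly restricted to the
    configurations with y(1) = 1, together with the generators of Q and the
    flip of y(1), each acting on the configurations over one letter, are packed
    into two permutations a and b of X, and K is the group they generate.

    Simplicity: a nontrivial n in K is continuous, so it moves some brick (a
    word times a cylinder of configurations) off itself, and the double
    commutator trick puts a 3-cycle of subbricks into the normal closure of n.
    K permutes words transitively and the flips permute the cylinders on given
    coordinates, so all 3-cycles of words are in the normal closure.  An
    element s of the lamplighter group acting on the word w acts on w0 and on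
    w1, so modulo the 3-cycles its class x satisfies x = 2x, i.e. x = 0.

    Two generators: b rotates an odd number of letters and a is a product of
    pieces on disjoint sets of letters, placed so that a and b a b^-1 interfere
    in a single letter; their commutator is a 3-cycle of letters.

    Undistortedness: over each point, an element of K acts on the configuration
    as a translation up to finitely many coordinates, and the length of the
    G-part of the translation grows at most linearly with the word length. *)

Require Import Defs.
From Stdlib Require Import Reals List ZArith Lia Lra ssreflect.
From Stdlib Require Import Classical ClassicalEpsilon FunctionalExtensionality ProofIrrelevance.

Local Open Scope nat_scope.
Set Implicit Arguments.
Unset Strict Implicit.
Unset Printing Implicit Defensive.

Notation "x ** y" := (gmul x y) (at level 40, left associativity).
Notation "x ^-1" := (ginv x) (at level 2, left associativity, format "x ^-1").

(** * Groups and permutations *)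

Section GroupTheory.
Variable G : Group.
Implicit Types (x y z : G) (H N : G -> Prop).

Lemma gmulKV x y : x ** y ** y^-1 = x.
Proof. by rewrite -gmul_assoc gmul_inv_r gmul_one_r. Qed.

Lemma gmulVK x y : x ** y^-1 ** y = x.
Proof. by rewrite -gmul_assoc gmul_inv_l gmul_one_r. Qed.

Lemma gmulI x y z : x ** y = x ** z -> y = z.
Proof.
by move=> e; rewrite -(gmul_one_l _ y) -(gmul_one_l _ z) -(gmul_inv_l _ x) -!gmul_assoc e.
Qed.

Lemma ginv_uniq x y : x ** y = gone -> y = x^-1.
Proof. by move=> e; apply: (@gmulI x); rewrite e gmul_inv_r. Qed.

Lemma ginv_mul x y : (x ** y)^-1 = y^-1 ** x^-1.
Proof.
symmetry; apply: ginv_uniq.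
by rewrite gmul_assoc gmulKV gmul_inv_r.
Qed.

Lemma ginvK x : (x^-1)^-1 = x.
Proof. by symmetry; apply: ginv_uniq; rewrite gmul_inv_l. Qed.

Lemma ginv1 : (gone : G)^-1 = gone.
Proof. by symmetry; apply: ginv_uniq; rewrite gmul_one_l. Qed.

Definition commute x y := x ** y = y ** x.

Lemma commute_sym x y : commute x y -> commute y x.
Proof. by rewrite /commute => ->. Qed.

Lemma commute_mul x y z : commute x y -> commute x z -> commute x (y ** z).
Proof. by rewrite /commute => e1 e2; rewrite gmul_assoc e1 -gmul_assoc e2 gmul_assoc. Qed.

Lemma commute_inv x y : commute x y -> commute x (y^-1).
Proof.
rewrite /commute => e.
by rewrite -{1}(gmulKV (y^-1 ** x) y) -(gmul_assoc _ (y^-1) x y) e gmul_assoc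
  gmul_inv_l gmul_one_l.
Qed.

Lemma conj_mul_commute h x y : commute h y -> h ** (x ** y) ** h^-1 = h ** x ** h^-1 ** y.
Proof.
by move=> /commute_sym /commute_inv e; rewrite -!gmul_assoc e.
Qed.

Lemma conj_div h x y : h ** (x ** y^-1) ** h^-1 = h ** x ** h^-1 ** (h ** y ** h^-1)^-1.
Proof. by rewrite !ginv_mul ginvK !gmul_assoc gmulVK. Qed.

Definition comm x y := x ** y ** x^-1 ** y^-1.

Lemma comm_mull x r y : commute r y -> comm (x ** r) y = comm x y.
Proof.
rewrite /comm /commute => e.
by rewrite ginv_mul -(gmul_assoc _ x r y) e !gmul_assoc gmulKV.
Qed.

Lemma comm_mulr x y r : commute r x -> comm x (y ** r) = comm x y.
Proof.
move=> /commute_inv e; rewrite /comm ginv_mul !gmul_assoc.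
by rewrite -(gmul_assoc _ (x ** y) r) e gmul_assoc gmulKV.
Qed.

Record is_subgroup H : Prop := IsSubgroup {
  sub1 : H gone;
  subM : forall x y, H x -> H y -> H (x ** y);
  subV : forall x, H x -> H (x^-1)
}.

Lemma sub_comm H : is_subgroup H -> forall x y, H x -> H y -> H (comm x y).
Proof.
move=> sH x y Hx Hy; rewrite /comm.
by do 3?[apply: (subM sH)]; rewrite ?Hx //; try exact: (subV sH).
Qed.

Lemma sub_conj H : is_subgroup H -> forall h x, H h -> H x -> H (h ** x ** h^-1).
Proof. by move=> sH h x Hh Hx; do 2?[apply: (subM sH)] => //; exact: (subV sH). Qed.

Lemma sub_cancell H : is_subgroup H -> forall x y, H x -> H (x ** y) -> H y.
Proof.
move=> sH x y Hx Hxy; rewrite -(gmul_one_l _ y) -(gmul_inv_l _ x) -gmul_assoc.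
by apply: (subM sH) => //; exact: (subV sH).
Qed.

(** Formulated for predicates so that N = H is allowed: the same transfer lemmas then produce
    elements of K and elements of a normal subgroup of K. *)
Definition normalized_by H N := forall h x, H h -> N x -> N (h ** x ** h^-1).

Lemma normal_comml H N : is_subgroup N -> is_subgroup H -> normalized_by H N ->
  forall x h, N x -> H h -> N (comm x h).
Proof.
move=> sN sH nHN x h Nx Hh; rewrite /comm -!gmul_assoc; apply: (subM sN) => //.
by rewrite gmul_assoc; apply: nHN => //; exact: (subV sN).
Qed.

Lemma normal_commr H N : is_subgroup N -> normalized_by H N ->
  forall h x, H h -> N x -> N (comm h x).
Proof.
by move=> sN nHN h x Hh Nx; apply: (subM sN); [exact: nHN | exact: (subV sN)].
Qed.

(* [[n, p], q] = [p^-1, q] because n p n^-1 commutes with p and q. *)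
Lemma normal_displaced H N : is_subgroup N -> is_subgroup H -> normalized_by H N ->
  forall n p q, N n -> H p -> H q ->
  commute (n ** p ** n^-1) p -> commute (n ** p ** n^-1) q -> N (comm (p^-1) q).
Proof.
move=> sN sH nHN n p q Nn Hp Hq cp cq.
have : N (comm (comm n p) q).
  by apply: (normal_comml sN sH nHN) => //; exact: (normal_comml sN sH nHN).
by rewrite {2}/comm (commute_inv cp) comm_mull.
Qed.

Inductive generated (B : G -> Prop) : G -> Prop :=
| gen_base x : B x -> generated B x
| gen_one : generated B gone
| gen_mul x y : generated B x -> generated B y -> generated B (x ** y)
| gen_inv x : generated B x -> generated B (x^-1).

Lemma generated_subgroup B : is_subgroup (generated B).
Proof. by split; [exact: gen_one | exact: gen_mul | exact: gen_inv]. Qed.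

Lemma generated_min B H : is_subgroup H -> (forall x, B x -> H x) ->
  forall x, generated B x -> H x.
Proof.
move=> sH BH x; elim=> {x} [x /BH //||x y _ Hx _ Hy|x _ Hx].
- exact: (sub1 sH).
- exact: (subM sH).
- exact: (subV sH).
Qed.

End GroupTheory.

(** * Permutations and symmetric groups *)

Record perm (T : Type) := Perm {
  fwd :> T -> T;
  bwd : T -> T;
  fwdK : forall x, bwd (fwd x) = x;
  bwdK : forall x, fwd (bwd x) = x
}.

Lemma perm_ext T (f g : perm T) : (forall x, f x = g x) -> f = g.
Proof.
case: f g => f f' fK f'K [g g' gK g'K] /= e.
have {}e : f = g by apply: functional_extensionality.
subst g.
have e' : f' = g' by apply: functional_extensionality => x; rewrite -{1}(g'K x) fK.
by subst g'; f_equal; apply: proof_irrelevance.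
Qed.

Definition perm_one T : perm T := @Perm T (fun x => x) (fun x => x) (fun x => eq_refl) (fun x => eq_refl).

Program Definition perm_mul T (f g : perm T) : perm T :=
  @Perm T (fun x => f (g x)) (fun x => bwd g (bwd f x)) _ _.
Next Obligation. by rewrite !fwdK. Qed.
Next Obligation. by rewrite !bwdK. Qed.

Definition perm_inv T (f : perm T) : perm T :=
  @Perm T (bwd f) (fwd f) (bwdK f) (fwdK f).

Program Definition Sym (T : Type) : Group :=
  @Build_Group (perm T) (@perm_mul T) (@perm_one T) (@perm_inv T) _ _ _ _ _.
Next Obligation. by exact: perm_ext. Qed.
Next Obligation. by exact: perm_ext. Qed.
Next Obligation. by exact: perm_ext. Qed.
Next Obligation. by apply: perm_ext => t /=; rewrite fwdK. Qed.
Next Obligation. by apply: perm_ext => t /=; rewrite bwdK. Qed.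

Lemma perm_inj T (f : perm T) x y : f x = f y -> x = y.
Proof. by move=> e; rewrite -(fwdK f x) e fwdK. Qed.

(** If f moves x then, by injectivity, it also moves f x, so g fixes both points and both products
    send x to f x. The case where g moves x is symmetric. *)
Lemma disjoint_commute T (f g : Sym T) :
  (forall x, (f : perm T) x = x \/ (g : perm T) x = x) -> commute f g.
Proof.
move=> dis; apply: perm_ext => x /=.
case: (dis x) => e.
  rewrite e; case: (dis ((g : perm T) x)) => // e'.
  by rewrite (perm_inj e').
rewrite e; case: (dis ((f : perm T) x)) => e' //.
by rewrite (perm_inj e').
Qed.

(** * 3-cycles of embedded pieces *)

Section Cycles.
Variables D X : Type.
Implicit Types (e : D -> X) (A B : D -> bool).

(** The inverse of [e] on its image, chosen classically; permutations are defined by cases on which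
    image contains the point. *)
Definition find e (x : X) : option D :=
  match excluded_middle_informative (exists d, e d = x) with
  | left h => Some (proj1_sig (constructive_indefinite_description _ h))
  | right _ => None
  end.

Lemma find_in e d : injective e -> find e (e d) = Some d.
Proof.
move=> inj; rewrite /find; case: excluded_middle_informative => [h|[]]; last by exists d.
by case: constructive_indefinite_description => d' /= /inj ->.
Qed.

Lemma find_out e x : (forall d, e d <> x) -> find e x = None.
Proof.
by move=> out; rewrite /find; case: excluded_middle_informative => // -[d /out []].
Qed.

(** The identity is a default value: permutations can be written down as plain functions, and the
    inverse laws are supplied only when they are evaluated. *)
Definition mkperm (f g : X -> X) : Sym X :=
  match excluded_middle_informative ((forall x, g (f x) = x) /\ (forall x, f (g x) = x)) with
  | left h => Perm (proj1 h) (proj2 h)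
  | right _ => @perm_one X
  end.

Lemma mkpermE (f g : X -> X) : (forall x, g (f x) = x) -> (forall x, f (g x) = x) ->
  forall x, (mkperm f g : perm X) x = f x.
Proof. by move=> fK gK x; rewrite /mkperm; case: excluded_middle_informative => // -[]. Qed.

Definition separate e1 e2 := forall d d', e1 d <> e2 d'.

Lemma separate_sym e1 e2 : separate e1 e2 -> separate e2 e1.
Proof. by move=> s d d' e; case: (s d' d). Qed.

(** The 3-cycles e1 d -> e2 d -> e3 d -> e1 d performed simultaneously for all d satisfying [A].
    Exchanging e2 and e3 inverts it. *)
Definition cycf e1 e2 e3 A x :=
  match find e1 x with Some d => if A d then e2 d else x | None =>
  match find e2 x with Some d => if A d then e3 d else x | None =>
  match find e3 x with Some d => if A d then e1 d else x | None => x
  end end end.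

(* Junk value 1 unless e1, e2, e3 are injective with disjoint images. *)
Definition cyc e1 e2 e3 A : Sym X := mkperm (cycf e1 e2 e3 A) (cycf e1 e3 e2 A).

Record triple e1 e2 e3 : Prop := Triple {
  tri_inj1 : injective e1; tri_inj2 : injective e2; tri_inj3 : injective e3;
  tri_sep12 : separate e1 e2; tri_sep23 : separate e2 e3; tri_sep31 : separate e3 e1
}.

Lemma triple_rot e1 e2 e3 : triple e1 e2 e3 -> triple e2 e3 e1.
Proof. by case. Qed.

Lemma triple_swap e1 e2 e3 : triple e1 e2 e3 -> triple e1 e3 e2.
Proof. by case=> *; split=> //; exact: separate_sym. Qed.

Lemma cycf1 e1 e2 e3 A d : triple e1 e2 e3 ->
  cycf e1 e2 e3 A (e1 d) = if A d then e2 d else e1 d.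
Proof. by case=> *; rewrite /cycf find_in. Qed.

Lemma cycf2 e1 e2 e3 A d : triple e1 e2 e3 ->
  cycf e1 e2 e3 A (e2 d) = if A d then e3 d else e2 d.
Proof. by case=> *; rewrite /cycf find_out // find_in. Qed.

Lemma cycf3 e1 e2 e3 A d : triple e1 e2 e3 ->
  cycf e1 e2 e3 A (e3 d) = if A d then e1 d else e3 d.
Proof.
by case=> ? ? ? ? ? s; rewrite /cycf find_out ?[find e2 _]find_out ?find_in //;
  move=> d' e; apply: (s d d').
Qed.

Lemma cycf0 e1 e2 e3 A x :
  (forall d, e1 d <> x) -> (forall d, e2 d <> x) -> (forall d, e3 d <> x) ->
  cycf e1 e2 e3 A x = x.
Proof. by move=> *; rewrite /cycf !find_out. Qed.

Lemma cycfK e1 e2 e3 A : triple e1 e2 e3 ->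
  forall x, cycf e1 e3 e2 A (cycf e1 e2 e3 A x) = x.
Proof.
move=> t x; have t' := triple_swap t.
case: (classic (exists d, e1 d = x)) => [[d <-]|n1].
  by rewrite cycf1 //; case E: (A d); rewrite ?cycf3 ?cycf1 ?E.
case: (classic (exists d, e2 d = x)) => [[d <-]|n2].
  by rewrite cycf2 //; case E: (A d); rewrite ?cycf2 ?cycf3 ?E.
case: (classic (exists d, e3 d = x)) => [[d <-]|n3].
  by rewrite cycf3 //; case E: (A d); rewrite ?cycf1 ?cycf2 ?E.
have n1' d : e1 d <> x by move=> e; apply: n1; exists d.
have n2' d : e2 d <> x by move=> e; apply: n2; exists d.
have n3' d : e3 d <> x by move=> e; apply: n3; exists d.
by rewrite [X in cycf _ _ _ _ X]cycf0 // cycf0.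
Qed.

Section Eval.
Variables (e1 e2 e3 : D -> X) (A : D -> bool).
Hypothesis t : triple e1 e2 e3.

Lemma cycE x : (cyc e1 e2 e3 A : perm X) x = cycf e1 e2 e3 A x.
Proof. by apply: mkpermE; apply: cycfK => //; exact: triple_swap. Qed.

Lemma cyc1 d : (cyc e1 e2 e3 A : perm X) (e1 d) = if A d then e2 d else e1 d.
Proof. by rewrite cycE cycf1. Qed.

Lemma cyc2 d : (cyc e1 e2 e3 A : perm X) (e2 d) = if A d then e3 d else e2 d.
Proof. by rewrite cycE cycf2. Qed.

Lemma cyc3 d : (cyc e1 e2 e3 A : perm X) (e3 d) = if A d then e1 d else e3 d.
Proof. by rewrite cycE cycf3. Qed.

Lemma cyc0 x : (forall d, e1 d <> x) -> (forall d, e2 d <> x) -> (forall d, e3 d <> x) ->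
  (cyc e1 e2 e3 A : perm X) x = x.
Proof. by move=> *; rewrite cycE cycf0. Qed.

Lemma cyc_sep f : separate f e1 -> separate f e2 -> separate f e3 ->
  forall d, (cyc e1 e2 e3 A : perm X) (f d) = f d.
Proof. by move=> s1 s2 s3 d; apply: cyc0 => d'; apply: not_eq_sym; [exact: s1|exact: s2|exact: s3]. Qed.

Lemma cyc_fix x : (forall d, A d = true -> e1 d <> x /\ e2 d <> x /\ e3 d <> x) ->
  (cyc e1 e2 e3 A : perm X) x = x.
Proof.
move=> out.
case: (classic (exists d, e1 d = x)) => [[d E]|n1].
  by rewrite -E cyc1; case EA: (A d) => //; case: (out d EA) => /(_ E).
case: (classic (exists d, e2 d = x)) => [[d E]|n2].
  by rewrite -E cyc2; case EA: (A d) => //; case: (out d EA) => _ [/(_ E)].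
case: (classic (exists d, e3 d = x)) => [[d E]|n3].
  by rewrite -E cyc3; case EA: (A d) => //; case: (out d EA) => _ [_ /(_ E)].
by apply: cyc0 => d E; [case: n1|case: n2|case: n3]; exists d.
Qed.

Lemma cyc_uniq (f : Sym X) :
  (forall d, (f : perm X) (e1 d) = if A d then e2 d else e1 d) ->
  (forall d, (f : perm X) (e2 d) = if A d then e3 d else e2 d) ->
  (forall d, (f : perm X) (e3 d) = if A d then e1 d else e3 d) ->
  (forall x, (forall d, e1 d <> x) -> (forall d, e2 d <> x) -> (forall d, e3 d <> x) ->
     (f : perm X) x = x) ->
  f = cyc e1 e2 e3 A.
Proof.
move=> f1 f2 f3 f0; apply: perm_ext => x.
case: (classic (exists d, e1 d = x)) => [[d <-]|n1]; first by rewrite f1 cyc1.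
case: (classic (exists d, e2 d = x)) => [[d <-]|n2]; first by rewrite f2 cyc2.
case: (classic (exists d, e3 d = x)) => [[d <-]|n3]; first by rewrite f3 cyc3.
have n1' d : e1 d <> x by move=> e; apply: n1; exists d.
have n2' d : e2 d <> x by move=> e; apply: n2; exists d.
have n3' d : e3 d <> x by move=> e; apply: n3; exists d.
by rewrite f0 // cyc0.
Qed.

End Eval.

Lemma cyc_rot e1 e2 e3 A : triple e1 e2 e3 -> cyc e1 e2 e3 A = cyc e2 e3 e1 A.
Proof.
move=> t; apply: cyc_uniq; first exact: triple_rot.
- by move=> d; rewrite cyc2.
- by move=> d; rewrite cyc3.
- by move=> d; rewrite cyc1.
- by move=> x *; rewrite cyc0.
Qed.

Lemma cyc_inv e1 e2 e3 A : triple e1 e2 e3 -> (cyc e1 e2 e3 A)^-1 = cyc e1 e3 e2 A.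
Proof.
move=> t; symmetry; apply: ginv_uniq; apply: perm_ext => x /=.
by rewrite cycE ?cycE //; [exact: triple_swap | apply: cycfK; exact: triple_swap].
Qed.

(** The conjugator carries each e_i to f_i up to a common reparametrisation s of [D], and the
    restriction A is transported along s. Taking a translation or a flip for s changes the condition
    on configurations. *)
Lemma cyc_conj (h : Sym X) (s : perm D) e1 e2 e3 f1 f2 f3 A : triple e1 e2 e3 ->
  (forall d, (h : perm X) (e1 d) = f1 (s d)) ->
  (forall d, (h : perm X) (e2 d) = f2 (s d)) ->
  (forall d, (h : perm X) (e3 d) = f3 (s d)) ->
  triple f1 f2 f3 /\
  h ** cyc e1 e2 e3 A ** h^-1 = cyc f1 f2 f3 (fun d => A (bwd s d)).
Proof.
move=> t h1 h2 h3.
have g1 d : f1 d = (h : perm X) (e1 (bwd s d)) by rewrite h1 bwdK.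
have g2 d : f2 d = (h : perm X) (e2 (bwd s d)) by rewrite h2 bwdK.
have g3 d : f3 d = (h : perm X) (e3 (bwd s d)) by rewrite h3 bwdK.
have inj e f : injective e -> (forall d, f d = (h : perm X) (e (bwd s d))) -> injective f.
  move=> ie E d d'; rewrite !E => e0.
  by apply: (@perm_inj _ (perm_inv s)); apply: ie; exact: perm_inj e0.
have sep e f e' f' : separate e e' -> (forall d, f d = (h : perm X) (e (bwd s d))) ->
    (forall d, f' d = (h : perm X) (e' (bwd s d))) -> separate f f'.
  by move=> se E E' d d'; rewrite E E' => e0; apply: se (perm_inj e0).
have tf : triple f1 f2 f3.
  case: t => i1 i2 i3 s12 s23 s31.
  by split; [exact: inj g1|exact: inj g2|exact: inj g3|exact: sep g1 g2|exact: sep g2 g3|exact: sep g3 g1].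
split=> //; apply: cyc_uniq => // [d|d|d|x n1 n2 n3] /=.
- by rewrite {1}g1 fwdK cyc1 //; case: (A _); rewrite ?g2 ?g1.
- by rewrite {1}g2 fwdK cyc2 //; case: (A _); rewrite ?g3 ?g2.
- by rewrite {1}g3 fwdK cyc3 //; case: (A _); rewrite ?g1 ?g3.
- rewrite cyc0 ?bwdK // => d e; [apply: (n1 (s d))|apply: (n2 (s d))|apply: (n3 (s d))];
    by rewrite -?h1 -?h2 -?h3 e bwdK.
Qed.

Lemma cyc_conj_id (h : Sym X) e1 e2 e3 f1 f2 f3 A : triple e1 e2 e3 ->
  (forall d, (h : perm X) (e1 d) = f1 d) ->
  (forall d, (h : perm X) (e2 d) = f2 d) ->
  (forall d, (h : perm X) (e3 d) = f3 d) ->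
  triple f1 f2 f3 /\ h ** cyc e1 e2 e3 A ** h^-1 = cyc f1 f2 f3 A.
Proof. by move=> t h1 h2 h3; exact: (@cyc_conj h (perm_one D)). Qed.

(** Over each d in both A and B this is the identity [(1 2 3), (1 4 5)] = (1 2 4) among permutations
    of five points; over any other d one of the two cycles is trivial, hence so is the
    commutator. *)
Lemma cyc_comm e1 e2 e3 e4 e5 A B :
  triple e1 e2 e3 -> triple e1 e4 e5 -> separate e2 e4 -> separate e2 e5 ->
  separate e3 e4 -> separate e3 e5 ->
  comm (cyc e1 e2 e3 A) (cyc e1 e4 e5 B) = cyc e1 e2 e4 (fun d => andb (A d) (B d)).
Proof.
move=> t t' s24 s25 s34 s35.
have [s42 s52] := (separate_sym s24, separate_sym s25).
have [s43 s53] := (separate_sym s34, separate_sym s35).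
have := t; have := t'.
move=> [i1 i4 i5 s14 s45 s51] [_ i2 i3 s12 s23 s31].
have [s41 s54] := (separate_sym s14, separate_sym s45).
have s15 := separate_sym s51.
have [s21 s32] := (separate_sym s12, separate_sym s23).
have s13 := separate_sym s31.
have [u u'] := (triple_swap t, triple_swap t').
rewrite /comm !cyc_inv //.
have p1 := cyc1 A t; have p2 := cyc2 A t; have p3 := cyc3 A t.
have p4 := cyc_sep A t s41 s42 s43; have p5 := cyc_sep A t s51 s52 s53.
have P1 := cyc1 A u; have P3 := cyc2 A u; have P2 := cyc3 A u.
have P4 := cyc_sep A u s41 s43 s42; have P5 := cyc_sep A u s51 s53 s52.
have q1 := cyc1 B t'; have q4 := cyc2 B t'; have q5 := cyc3 B t'.
have q2 := cyc_sep B t' s21 s24 s25; have q3 := cyc_sep B t' s31 s34 s35.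
have Q1 := cyc1 B u'; have Q5 := cyc2 B u'; have Q4 := cyc3 B u'.
have Q2 := cyc_sep B u' s21 s25 s24; have Q3 := cyc_sep B u' s31 s35 s34.
have ev :=(p1,p2,p3,p4,p5,(P1,P2,P3,P4,P5),(q1,q2,q3,q4,q5),(Q1,Q2,Q3,Q4,Q5)).
have e1E d : (cyc e1 e2 e3 A ** cyc e1 e4 e5 B ** cyc e1 e3 e2 A ** cyc e1 e5 e4 B : perm X)
    (e1 d) = if A d && B d then e2 d else e1 d.
  by case EA: (A d); case EB: (B d); do !rewrite /= ?ev ?EA ?EB.
apply: cyc_uniq => //.
- by move=> d; case EA: (A d); case EB: (B d); do !rewrite /= ?ev ?EA ?EB.
- by move=> d; case EA: (A d); case EB: (B d); do !rewrite /= ?ev ?EA ?EB.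
- move=> x n1 n2 n4.
  case: (classic (exists d, e3 d = x)) => [[d <-]|n3].
    by case EA: (A d); case EB: (B d); do !rewrite /= ?ev ?EA ?EB.
  case: (classic (exists d, e5 d = x)) => [[d <-]|n5].
    by case EA: (A d); case EB: (B d); do !rewrite /= ?ev ?EA ?EB.
  have n3' d : e3 d <> x by move=> e; apply: n3; exists d.
  have n5' d : e5 d <> x by move=> e; apply: n5; exists d.
  by rewrite /= !cyc0.
Qed.

Lemma cyc_disjoint_union e1 e2 e3 A B : triple e1 e2 e3 ->
  (forall d, A d = true -> B d = false) ->
  cyc e1 e2 e3 (fun d => orb (A d) (B d)) = cyc e1 e2 e3 A ** cyc e1 e2 e3 B.
Proof.
move=> t dis; symmetry; apply: cyc_uniq => // [d|d|d|x n1 n2 n3] /=.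
- rewrite cyc1 //; case EB: (B d); rewrite ?cyc1 ?cyc2 ?cyc3 //; case EA: (A d) => //=;
  by rewrite ?(dis _ EA) in EB.
- rewrite cyc2 //; case EB: (B d); rewrite ?cyc1 ?cyc2 ?cyc3 //; case EA: (A d) => //=;
  by rewrite ?(dis _ EA) in EB.
- rewrite cyc3 //; case EB: (B d); rewrite ?cyc1 ?cyc2 ?cyc3 //; case EA: (A d) => //=;
  by rewrite ?(dis _ EA) in EB.
- by rewrite !cyc0.
Qed.

(** * Permutations acting inside one piece *)

Definition atf e (s : D -> D) x := match find e x with Some d => e (s d) | None => x end.

Definition at_piece e (s : perm D) : Sym X := mkperm (atf e s) (atf e (bwd s)).

Lemma atfE e s d : injective e -> atf e s (e d) = e (s d).
Proof. by move=> i; rewrite /atf find_in. Qed.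

Lemma atf0 e s x : (forall d, e d <> x) -> atf e s x = x.
Proof. by move=> i; rewrite /atf find_out. Qed.

Section EvalAt.
Variable (e : D -> X) (s : perm D).
Hypothesis inj : injective e.

Lemma atfun x : (at_piece e s : perm X) x = atf e s x.
Proof.
apply: mkpermE => {}x; case: (classic (exists d, e d = x)) => [[d <-]|n].
- by rewrite !atfE // fwdK.
- by rewrite !atf0 // => d E; apply: n; exists d.
- by rewrite !atfE // bwdK.
- by rewrite !atf0 // => d E; apply: n; exists d.
Qed.

Lemma atE d : (at_piece e s : perm X) (e d) = e (s d).
Proof. by rewrite atfun atfE. Qed.

Lemma at0 x : (forall d, e d <> x) -> (at_piece e s : perm X) x = x.
Proof. by move=> n; rewrite atfun atf0. Qed.

Lemma at_sep f : separate f e -> forall d, (at_piece e s : perm X) (f d) = f d.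
Proof. by move=> sf d; apply: at0 => d'; apply: not_eq_sym; exact: sf. Qed.

Lemma at_uniq (f : Sym X) : (forall d, (f : perm X) (e d) = e (s d)) ->
  (forall x, (forall d, e d <> x) -> (f : perm X) x = x) -> f = at_piece e s.
Proof.
move=> f1 f0; apply: perm_ext => x.
case: (classic (exists d, e d = x)) => [[d <-]|n]; first by rewrite f1 atE.
by rewrite f0 ?at0 // => d E; apply: n; exists d.
Qed.

End EvalAt.

Lemma at_mul e (s s' : perm D) : injective e ->
  at_piece e (perm_mul s s') = at_piece e s ** at_piece e s'.
Proof.
move=> i; symmetry; apply: at_uniq => // [d|x n] /=; first by rewrite !atE.
by rewrite !at0.
Qed.

Lemma at_inv e (s : perm D) : injective e -> at_piece e (perm_inv s) = (at_piece e s)^-1.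
Proof.
move=> i; apply: ginv_uniq; rewrite -at_mul //; symmetry; apply: at_uniq => // d /=.
by rewrite bwdK.
Qed.

Lemma at_conj (h : Sym X) e f (s : perm D) : injective e ->
  (forall d, (h : perm X) (e d) = f d) ->
  injective f /\ h ** at_piece e s ** h^-1 = at_piece f s.
Proof.
move=> i E; have i' : injective f by move=> d d'; rewrite -!E => e0; exact: i (perm_inj e0).
split=> //; apply: at_uniq => // [d|x n] /=.
- by rewrite -!E fwdK atE.
- by rewrite at0 ?bwdK // => d Ed; apply: (n d); rewrite -E Ed bwdK.
Qed.

End Cycles.

(** * The two-generator group *)

Lemma fresh_nat (n : nat) (l : list nat) : length l < n -> exists p, p < n /\ ~ In p l.
Proof.
move=> ln; apply: NNPP => none.
have : incl (seq 0 n) l.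
  move=> p /in_seq [_ pn]; apply: NNPP => nin; apply: none; exists p; split=> //; lia.
move/(NoDup_incl_length (seq_NoDup n 0)); rewrite length_seq; lia.
Qed.

Section TwoGenerators.
Variables (Y : Type) (A0 : Y -> bool) (gens : list (perm Y)).

Definition D : Type := (nat -> bool) * Y.
(* The first component is the letter; only the letters below [letters] are moved by K. *)
Definition X : Type := nat * D.

Definition cons_bit (i : bool) (x : D) : D :=
  (fun n => match n with 0 => i | S n => fst x n end, snd x).

Fixpoint prepend (w : list bool) (x : D) : D :=
  match w with [] => x | i :: w => cons_bit i (prepend w x) end.

Definition piece (p : nat) (w : list bool) (x : D) : X := (p, prepend w x).
Notation L p := (piece p []).

Definition on (A : Y -> bool) (x : D) : bool := A (snd x).
Definition full : Y -> bool := fun _ => true.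

Definition lift (s : perm Y) : perm D.
Proof.
refine (@Perm _ (fun x : D => (fst x, s (snd x))) (fun x : D => (fst x, bwd s (snd x))) _ _).
- by move=> [z y] /=; rewrite fwdK.
- by move=> [z y] /=; rewrite bwdK.
Defined.

Lemma cons_bit_inj i x y j : cons_bit i x = cons_bit j y -> i = j /\ x = y.
Proof.
case: x y => [z x] [z' y]; rewrite /cons_bit /= => -[e ->]; split.
- by have := f_equal (fun f => f 0) e.
- by congr pair; apply: functional_extensionality => n; have := f_equal (fun f => f (S n)) e.
Qed.

Lemma prepend_inj w : injective (prepend w).
Proof. by elim: w => [//|i w IH] x y /cons_bit_inj [_ /IH]. Qed.

Lemma prepend_app v w x : prepend (v ++ w) x = prepend v (prepend w x).
Proof. by elim: v => //= i v ->. Qed.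

Lemma piece_inj p w : injective (piece p w).
Proof. by move=> x y [] /prepend_inj. Qed.

Lemma piece_sep p v q w : p <> q -> separate (piece p v) (piece q w).
Proof. by move=> ne x y [] /ne. Qed.

Lemma piece_sep_words p v w : length v = length w -> v <> w -> separate (piece p v) (piece p w).
Proof.
move=> l ne x y [] e; apply: ne; elim: v w l e => [|i v IH] [|j w] //= [l].
by move=> /cons_bit_inj [-> e]; rewrite (IH _ l e).
Qed.

Lemma piece_sep_app p u v w : separate (piece p v) (piece p w) -> separate (piece p (u ++ v)) (piece p (u ++ w)).
Proof. by move=> s x y []; rewrite !prepend_app => /prepend_inj e; apply: (s x y); rewrite /piece e. Qed.

Lemma piece_triple p q r u v w : p <> q -> q <> r -> r <> p ->
  triple (piece p u) (piece q v) (piece r w).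
Proof. by move=> pq qr rp; split; try exact: piece_inj; exact: piece_sep. Qed.

(** * 3-cycles of letters, supports and the two generators *)

Definition c3 p q r A : Sym X := cyc (L p) (L q) (L r) (on A).

Lemma cyc_off p q r u v w A s x : s <> p -> s <> q -> s <> r ->
  (cyc (piece p u) (piece q v) (piece r w) A : perm X) (s, x) = (s, x).
Proof.
rewrite /cyc /mkperm => *; case: excluded_middle_informative => //= -[_ _].
by rewrite cycf0 // => d [] e; congruence.
Qed.

Definition supported (E : nat -> Prop) (f : Sym X) :=
  forall p x, ~ E p -> (f : perm X) (p, x) = (p, x).

Lemma supported_mul E F f g : supported E f -> supported F g ->
  supported (fun p => E p \/ F p) (f ** g).
Proof. by move=> sf sg p x n /=; rewrite sg ?sf //; tauto. Qed.

Lemma supported_cyc p q r u v w A :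
  supported (fun s => s = p \/ s = q \/ s = r) (cyc (piece p u) (piece q v) (piece r w) A).
Proof. by move=> s x n; apply: cyc_off; tauto. Qed.

Lemma supported_at p (s : perm D) : supported (fun r => r = p) (at_piece (L p) s).
Proof. by move=> r x n; rewrite at0 //; [exact: piece_inj | move=> d []; auto]. Qed.

Lemma supported_commute E F f g : supported E f -> supported F g ->
  (forall p, E p -> F p -> False) -> commute f g.
Proof.
move=> sf sg EF; apply: disjoint_commute => -[p x].
case: (classic (E p)) => Ep; [right; apply: sg | left; exact: sf].
exact: EF.
Qed.

(** The factors of [rest] use even letters up to 22 + 2 * length gens, which is below 2 * half; the
    constant 15 also guarantees 31 letters, enough for every later choice of fresh letters. *)
Definition half := length gens + 15.
Definition letters := 2 * half + 1.

(* [brot n] is the cycle of length 2n + 1: an odd cycle length makes it a product of 3-cycles. *)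
Fixpoint brot n : Sym X :=
  match n with 0 => gone | S n => brot n ** c3 (2 * n) (2 * n + 1) (2 * n + 2) full end.

Fixpoint along_letters j (l : list (perm Y)) : Sym X :=
  match l with [] => gone | s :: l => at_piece (L j) (lift s) ** along_letters (j + 2) l end.

Definition gen_b : Sym X := brot half.
(** Each of [mix0] and [mix1] identifies one half of a letter with whole letters; together they seed
    the prefix replacements, as in the Higman-Thompson groups. *)
Definition mix0 : Sym X := cyc (piece 6 [false]) (L 8) (L 10) (on full).
Definition mix1 : Sym X := cyc (piece 12 [true]) (L 14) (L 16) (on full).
(* All components of [rest] live on disjoint sets of even letters from 6 on; the odd letters
   are left free for conjugation. *)
Definition rest : Sym X := mix0 ** (mix1 ** (c3 18 20 22 A0 ** along_letters 24 gens)).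
Definition gen_a : Sym X := c3 0 1 3 full ** rest.

Definition K : Sym X -> Prop := generated (fun f => f = gen_a \/ f = gen_b).

Lemma c3_1 p q r x : p <> q -> q <> r -> r <> p -> (c3 p q r full : perm X) (p, x) = (q, x).
Proof.
by move=> pq qr rp; have := @cyc1 _ _ (L p) (L q) (L r) (on full) (piece_triple _ _ _ pq qr rp) x.
Qed.

Lemma c3_2 p q r x : p <> q -> q <> r -> r <> p -> (c3 p q r full : perm X) (q, x) = (r, x).
Proof.
by move=> pq qr rp; have := @cyc2 _ _ (L p) (L q) (L r) (on full) (piece_triple _ _ _ pq qr rp) x.
Qed.

Lemma c3_3 p q r x : p <> q -> q <> r -> r <> p -> (c3 p q r full : perm X) (r, x) = (p, x).
Proof.
by move=> pq qr rp; have := @cyc3 _ _ (L p) (L q) (L r) (on full) (piece_triple _ _ _ pq qr rp) x.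
Qed.

Lemma c3_0 p q r A s x : s <> p -> s <> q -> s <> r -> (c3 p q r A : perm X) (s, x) = (s, x).
Proof. exact: cyc_off. Qed.

Lemma brot_hi n p x : 2 * n < p -> (brot n : perm X) (p, x) = (p, x).
Proof.
elim: n => [//|n IH] lt; rewrite [brot _]/=.
have -> : (brot n ** c3 (2 * n) (2 * n + 1) (2 * n + 2) full : perm X) (p, x) =
  (brot n : perm X) ((c3 (2 * n) (2 * n + 1) (2 * n + 2) full : perm X) (p, x)) by [].
rewrite c3_0 ?IH //; lia.
Qed.

Lemma brot_last n x : (brot n : perm X) (2 * n, x) = (0, x).
Proof.
elim: n => [//|n IH]; rewrite [brot _]/=.
have -> : (brot n ** c3 (2 * n) (2 * n + 1) (2 * n + 2) full : perm X) (2 * S n, x) =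
  (brot n : perm X) ((c3 (2 * n) (2 * n + 1) (2 * n + 2) full : perm X) (2 * S n, x)) by [].
have -> : 2 * S n = 2 * n + 2 by lia.
rewrite c3_3 ?IH //; lia.
Qed.

Lemma brot_lo n p x : p < 2 * n -> (brot n : perm X) (p, x) = (p + 1, x).
Proof.
elim: n => [|n IH] lt; first lia; rewrite [brot _]/=.
have -> : (brot n ** c3 (2 * n) (2 * n + 1) (2 * n + 2) full : perm X) (p, x) =
  (brot n : perm X) ((c3 (2 * n) (2 * n + 1) (2 * n + 2) full : perm X) (p, x)) by [].
have [lt'|[->|->]] : p < 2 * n \/ p = 2 * n \/ p = 2 * n + 1 by lia.
- rewrite c3_0 ?IH //; lia.
- rewrite c3_1 ?brot_hi //; lia.
- rewrite c3_2 ?brot_hi; try lia; f_equal; lia.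
Qed.

Definition shift p := if p =? 2 * half then 0 else p + 1.

Lemma gen_bE p x : p < letters -> (gen_b : perm X) (p, x) = (shift p, x).
Proof.
rewrite /letters /shift => lt; case: Nat.eqb_spec => [->|ne]; first exact: brot_last.
apply: brot_lo; lia.
Qed.

Lemma K_subgroup : is_subgroup K.
Proof. exact: generated_subgroup. Qed.

Lemma gen_a_in_K : K gen_a. Proof. by apply: gen_base; left. Qed.
Lemma gen_b_in_K : K gen_b. Proof. by apply: gen_base; right. Qed.

Lemma K_normalized : normalized_by K K.
Proof. by move=> h f; exact: sub_conj K_subgroup _ _. Qed.

(** * Moving 3-cycles by conjugation *)

Section Transfer.
Variable N : Sym X -> Prop.
Hypothesis sN : is_subgroup N.
Hypothesis nN : normalized_by K N.

Lemma N_conj h e1 e2 e3 f1 f2 f3 (A : D -> bool) : triple e1 e2 e3 -> K h ->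
  (forall x, (h : perm X) (e1 x) = f1 x) ->
  (forall x, (h : perm X) (e2 x) = f2 x) ->
  (forall x, (h : perm X) (e3 x) = f3 x) ->
  N (cyc e1 e2 e3 A) -> N (cyc f1 f2 f3 A).
Proof.
move=> t Kh h1 h2 h3 /(nN Kh).
by have [_ ->] := cyc_conj_id A t h1 h2 h3.
Qed.

(** Conjugation by the cycle (p f g) replaces p by f and leaves q and r in place. *)
Lemma N_step p q r f g A : NoDup [p; q; r; f; g] -> K (c3 p f g full) ->
  N (c3 p q r A) -> N (c3 f q r A).
Proof.
move=> nd Kc; rewrite !NoDup_cons_iff /= in nd.
apply: (N_conj (h := c3 p f g full)) => //.
- apply: piece_triple; intuition.
- by move=> x; apply: c3_1; intuition.
- by move=> x; apply: c3_0; intuition.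
- by move=> x; apply: c3_0; intuition.
Qed.

Lemma N_rot p q r A : p <> q -> q <> r -> r <> p -> N (c3 p q r A) -> N (c3 q r p A).
Proof. by move=> *; rewrite /c3 -cyc_rot //; exact: piece_triple. Qed.

Lemma N_swap p q r A : p <> q -> q <> r -> r <> p -> N (c3 p q r A) -> N (c3 p r q A).
Proof. by move=> pq qr rp Nc; rewrite /c3 -cyc_inv; [exact: piece_triple|exact: (subV sN)]. Qed.

End Transfer.

Ltac ndup := repeat (apply NoDup_cons; [simpl; lia |]); apply NoDup_nil.

Lemma along_letters_supported j l : supported (fun p => exists i, p = j + 2 * i /\ i < length l) (along_letters j l).
Proof.
elim: l j => [|s l IH] j p x n //=.
rewrite IH; first by move=> [i [e lt]]; apply: n; exists (S i); split=> /=; lia.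
apply: supported_at => e; apply: n; exists 0; split=> /=; lia.
Qed.

(** The bound excludes the last letter 2 * half, so conjugation by b shifts these letters to odd
    ones without wrapping around. *)
Definition even_letters p := exists i, p = 6 + 2 * i /\ p < 2 * half.

Lemma supported_mono (E F : nat -> Prop) f : supported E f -> (forall p, E p -> F p) -> supported F f.
Proof. by move=> s EF p x n; apply: s => /EF. Qed.

Lemma rest_supported : supported even_letters rest.
Proof.
apply: supported_mono.
  apply: supported_mul; first exact: supported_cyc.
  apply: supported_mul; first exact: supported_cyc.
  apply: supported_mul; first exact: supported_cyc.
  exact: along_letters_supported.
rewrite /even_letters /half => p [[->|[->|->]]|[[->|[->|->]]|[[->|[->|->]]|[i [-> lt]]]]].
all: [> exists 0 | exists 1 | exists 2 | exists 3 | exists 4 | exists 5 | exists 6 | exists 7 | exists 8 | exists (9 + i)]; lia.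
Qed.

Lemma b_fix f p x : p < letters -> ~ even_letters p -> supported even_letters f ->
  (gen_b ** f ** gen_b^-1 : perm X) (shift p, x) = (shift p, x).
Proof.
move=> lt n sf /=.
have e : bwd gen_b (shift p, x) = (p, x) by rewrite -gen_bE // fwdK.
by rewrite [bwd gen_b _]e sf // gen_bE.
Qed.

(* [rest] commutes with its conjugate by b, since they live on even and odd letters, and {0, 1, 3} meets {1, 2, 4}
   in one letter; so [a, b a b^-1] = [(0 1 3), (1 2 4)]. *)
Lemma K_c3_132 : K (c3 1 3 2 full).
Proof.
have := sub_comm K_subgroup gen_a_in_K (K_normalized gen_b_in_K gen_a_in_K).
have kge : 15 <= half by rewrite /half; lia.
have E : gen_b ** gen_a ** gen_b^-1 = c3 1 2 4 full ** (gen_b ** rest ** gen_b^-1).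
  have t : @triple D X (L 0) (L 1) (L 3) by apply: piece_triple.
  have [_ <-] : triple (L 1) (L 2) (L 4) /\ gen_b ** c3 0 1 3 full ** gen_b^-1 = c3 1 2 4 full.
    by apply: cyc_conj_id => // x; rewrite /piece /= gen_bE /letters ?/shift; try lia; case: Nat.eqb_spec => //; lia.
  by rewrite /gen_a !gmul_assoc gmulVK.
rewrite E /gen_a.
have rr := rest_supported.
have odd p : p < letters -> ~ even_letters p -> forall x, (gen_b ** rest ** gen_b^-1 : perm X) (shift p, x) = (shift p, x).
  by move=> lt n x; exact: b_fix.
have shiftS p : p < 2 * half -> shift p = S p.
  by rewrite /shift => lt; case: Nat.eqb_spec; lia.
have ne p : p < 6 -> ~ even_letters p by rewrite /even_letters => ? [i []]; lia.
have c1 : commute rest (c3 1 2 4 full ** (gen_b ** rest ** gen_b^-1)).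
  apply: commute_mul.
    apply: (supported_commute rr (@supported_cyc 1 2 4 [] [] [] (on full))).
    by rewrite /even_letters => p [i []]; lia.
  apply: disjoint_commute => -[p x].
  case: (classic (even_letters p)) => [[i [-> lt]]|n]; last by left; exact: rr.
  right; have -> : 6 + 2 * i = shift (5 + 2 * i) by rewrite shiftS; lia.
  by apply: odd; rewrite /letters ?/even_letters; [lia|move=> [j []]; lia].
have c2 : commute (gen_b ** rest ** gen_b^-1) (c3 0 1 3 full).
  apply: disjoint_commute => -[p x].
  case: (classic (p = 0)) => [->|n0].
    (* Letter 0 is the image of the last letter 2 * half, on which [rest] is trivial. *)
    left; have -> : 0 = shift (2 * half) by rewrite /shift Nat.eqb_refl.
    by apply: odd; rewrite /letters ?/even_letters; [lia|move=> [j []]; lia].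
  case: (classic (p = 1)) => [->|n1].
    left; have -> : 1 = shift 0 by rewrite shiftS; lia.
    by apply: odd; [rewrite /letters; lia|apply: ne; lia].
  case: (classic (p = 3)) => [->|n3]; last by right; apply: c3_0.
  left; have -> : 3 = shift 2 by rewrite shiftS; lia.
  by apply: odd; [rewrite /letters; lia|apply: ne; lia].
rewrite (comm_mull _ c1) (comm_mulr _ c2).
(* Rotated so that the shared letter 1 comes first, as in [cyc_comm]. *)
have -> : c3 0 1 3 full = c3 1 3 0 full by apply: cyc_rot; exact: piece_triple.
by rewrite /c3 cyc_comm //; try exact: piece_triple; exact: piece_sep.
Qed.

(** * All 3-cycles of letters *)

Lemma letters_ge : 31 <= letters. Proof. by rewrite /letters /half; lia. Qed.

Lemma fresh (l : list nat) : length l < 31 -> exists p, p < letters /\ ~ In p l.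
Proof. by move=> ll; apply: fresh_nat; have := letters_ge; lia. Qed.

Ltac split_neq := cbn [In] in *; repeat match goal with
  | H : ~ (_ \/ _) |- _ => apply not_or_and in H; destruct H
  | H : _ /\ _ |- _ => destruct H end.
Ltac neq := solve [assumption | apply: not_eq_sym; assumption].

Definition K_c3 p q r := K (c3 p q r full).

Lemma K_c3_shift p q r : p < letters -> q < letters -> r < letters -> p <> q -> q <> r -> r <> p ->
  K_c3 p q r -> K_c3 (shift p) (shift q) (shift r).
Proof.
move=> pd qd rd pq qr rp.
by apply: (N_conj K_normalized (piece_triple [] [] [] pq qr rp) gen_b_in_K) => x; exact: gen_bE.
Qed.

Lemma K_c3_step p q r f g : NoDup [p; q; r; f; g] -> K_c3 p f g -> K_c3 p q r -> K_c3 f q r.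
Proof. exact: (N_step K_normalized). Qed.

Lemma K_c3_rot p q r : p <> q -> q <> r -> r <> p -> K_c3 p q r -> K_c3 q r p.
Proof. exact: N_rot. Qed.

Lemma K_c3_swap p q r : p <> q -> q <> r -> r <> p -> K_c3 p q r -> K_c3 p r q.
Proof. exact: (N_swap K_subgroup). Qed.

Lemma shift_lt p : p + 1 < letters -> shift p = p + 1.
Proof. by rewrite /shift /letters => lt; case: Nat.eqb_spec; lia. Qed.

Lemma K_c3_012 : K_c3 0 1 2.
Proof.
have t : @triple D X (L 1) (L 2) (L 3) by apply: piece_triple.
have e p x : p < 5 -> (gen_b^-1 : perm X) (S p, x) = (p, x).
  move=> lt; have ge := letters_ge; have pd : p < letters by lia.
  have -> : S p = shift p by rewrite shift_lt; lia.
  by rewrite -(gen_bE x pd) /= fwdK.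

apply: (N_conj K_normalized (h := gen_b^-1) t (subV K_subgroup gen_b_in_K)) => [x|x|x|]; try (apply: e; lia).
by apply: K_c3_swap => //; exact: K_c3_132.
Qed.

Lemma K_c3_consecutive i : i + 2 < letters -> K_c3 i (i + 1) (i + 2).
Proof.
elim: i => [|i IH] lt; first exact: K_c3_012.
have := @K_c3_shift i (i + 1) (i + 2).
rewrite !shift_lt; try lia.
replace (i + 1 + 1) with (S i + 1) by lia; replace (i + 2 + 1) with (S i + 2) by lia.
by replace (i + 1) with (S i) by lia; apply; try lia; rewrite -(Nat.add_1_r i); apply: IH; lia.
Qed.

(** By induction: the cycle (j j+1 j+2) of consecutive letters conjugates (j 0 1) to (j+1 0 1). *)
Lemma K_c3_01 j : 2 <= j -> j < letters -> K_c3 0 1 j.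
Proof.
have dge := letters_ge.
elim: j => [|j IH] ge lt; first lia.
case: (Nat.eq_dec j 1) => [->|n1]; first exact: K_c3_012.
have IHj : K_c3 j 0 1 by apply: K_c3_rot; [..|apply: K_c3_rot; [..|apply: IH]]; lia.
suff : K_c3 (S j) 0 1 by apply: K_c3_rot; lia.
case: (classic (j + 2 < letters)) => [lt2|nlt].
  apply: (@K_c3_step j _ _ (S j) (j + 2)) => //; first by ndup.
  by have := K_c3_consecutive lt2; rewrite Nat.add_1_r.
(* Here j + 1 is the last letter, so j - 1 takes the place of j + 2 in the conjugating cycle. *)
apply: (@K_c3_step j _ _ (S j) (j - 1)) => //; first by ndup.
apply: K_c3_rot; try lia.
have := @K_c3_consecutive (j - 1) ltac:(lia).
have -> : j - 1 + 1 = j by lia.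
by have -> : j - 1 + 2 = S j by lia.
Qed.

(** Repeated conjugation by b, which shifts all three letters cyclically, reduces to the cycles (0 1
    j). *)
Lemma K_c3_adjacent i j : i + 1 < letters -> j < letters -> j <> i -> j <> i + 1 -> K_c3 i (i + 1) j.
Proof.
have dge := letters_ge.
elim: i j => [|i IH] j lt jd ji ji'; first by apply: K_c3_01; lia.
have [j' [j'd e]] : exists j', j' < letters /\ shift j' = j.
  case: (Nat.eq_dec j 0) => [->|j0].
    by exists (2 * half); rewrite /shift Nat.eqb_refl /letters; split; lia.
  by exists (j - 1); rewrite shift_lt; lia.
have [n1 n2] : j' <> i /\ j' <> i + 1.
  by split=> e'; subst j'; rewrite shift_lt in e; lia.
have := @K_c3_shift i (i + 1) j'.
rewrite e !shift_lt; try lia.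
replace (i + 1 + 1) with (S i + 1) by lia.
by replace (i + 1) with (S i) by lia; apply; try lia; rewrite -(Nat.add_1_r i); apply: IH; lia.
Qed.

Lemma K_c3_up p q r : p + 1 < letters -> NoDup [p; q; r; p + 1] -> K_c3 p q r -> K_c3 (p + 1) q r.
Proof.
move=> lt nd t; have [g [gd ng]] := @fresh [p; q; r; p + 1] ltac:(simpl; lia).
rewrite !NoDup_cons_iff /= in nd ng.
apply: (@K_c3_step p _ _ (p + 1) g) => //; last by apply: K_c3_adjacent; lia.
ndup.
Qed.

(** Starting from (0 1 r), the letter 1 is raised to q and then 0 is raised to p, one step at a
    time. *)
Lemma K_c3_of_lt p q r : p < q -> q < r -> r < letters -> K_c3 p q r.
Proof.
move=> pq qr rd.
have H1 q' : 1 <= q' -> q' < r -> K_c3 q' r 0.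
  elim: q' => [|q' IH] ge lt; first lia.
  case: (Nat.eq_dec q' 0) => [->|n0].
    by apply: K_c3_rot; try lia; apply: K_c3_01; lia.
  by rewrite -Nat.add_1_r; apply: K_c3_up; [lia|ndup|apply: IH; lia].
elim: p pq => [|p IH] pq.
  by do 2?[apply: K_c3_rot; try lia]; apply: H1; lia.
by rewrite -Nat.add_1_r; apply: K_c3_up; [lia|ndup|apply: IH; lia].
Qed.

Lemma K_c3_all p q r : p < letters -> q < letters -> r < letters -> p <> q -> q <> r -> r <> p -> K_c3 p q r.
Proof.
move=> pd qd rd pq qr rp.
have H p' q' r' : p' < letters -> q' < letters -> r' < letters -> p' <> q' -> q' <> r' -> r' <> p' ->
    p' < q' -> p' < r' -> K_c3 p' q' r'.
  move=> *; case: (Nat.lt_ge_cases q' r') => c; first exact: K_c3_of_lt.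
  by apply: K_c3_swap; try lia; apply: K_c3_of_lt; lia.
have [[c c']|[[c c']|[c c']]] : p < q /\ p < r \/ q < r /\ q < p \/ r < p /\ r < q by lia.
- exact: H.
- by do 2?[apply: K_c3_rot; try lia]; apply: H; lia.
- by apply: K_c3_rot; try lia; apply: H; lia.
Qed.

(* Conjugate x * f by a permutation h of letters that moves two letters of x to fresh ones and commutes with f:
   then [x * f, h x h^-1 * f] = [x, h x h^-1] is a 3-cycle. *)
Lemma isolate p w l m A E f : p < letters -> l < letters -> m < letters -> supported E f ->
  (forall q, E q -> ~ In q [p; l; m; 5; 7; 9; 11]) -> NoDup [p; l; m; 5; 7; 9; 11] ->
  K (cyc (piece p w) (L l) (L m) (on A) ** f) -> K (cyc (piece p w) (L l) (L m) (on A)) /\ K f.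
Proof.
move=> pd ld md sf dis nd Kxf.
have dge := letters_ge.
rewrite !NoDup_cons_iff in nd; split_neq.
set x := cyc _ _ _ _ in Kxf *.
(* h moves l to 5 and m to 7; the letters 9 and 11 only complete its two 3-cycles. *)
set h := c3 l 5 9 full ** c3 m 7 11 full.
have lt n : n < 31 -> n < letters by move: dge; clear; lia.
have Kh : K h by apply: (subM K_subgroup); apply: K_c3_all; try neq; apply: lt; clear; lia.
have t : triple (piece p w) (L l) (L m) by apply: piece_triple; neq.
have hl y : (h : perm X) (l, y) = (5, y) by rewrite /h /= c3_0 ?c3_1 //; neq.
have hm y : (h : perm X) (m, y) = (7, y) by rewrite /h /= c3_1 ?c3_0 //; neq.
have h0 q y : ~ In q [l; m; 5; 7; 9; 11] -> (h : perm X) (q, y) = (q, y).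
  by move=> nq; split_neq; rewrite /h /= !c3_0 //; neq.
have [t' E1] : triple (piece p w) (L 5) (L 7) /\ h ** x ** h^-1 = cyc (piece p w) (L 5) (L 7) (on A).
  by apply: (cyc_conj_id _ t) => y; [apply: h0 => /=; intuition|exact: hl|exact: hm].
have sh : supported (fun q => q = l \/ q = 5 \/ q = 9 \/ q = m \/ q = 7 \/ q = 11) h.
  by move=> q y nq; apply: h0 => nin; apply: nq; simpl in nin; intuition auto.
have E2 : h ** (x ** f) ** h^-1 = cyc (piece p w) (L 5) (L 7) (on A) ** f.
  have c : commute h f by apply: (supported_commute sh sf) => q e /dis n; clear -e n; intuition auto.
  by rewrite conj_mul_commute ?E1.
have := sub_comm K_subgroup Kxf (K_normalized Kh Kxf).
have c1 : commute f (cyc (piece p w) (L 5) (L 7) (on A)).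
  by apply: (supported_commute sf (@supported_cyc _ _ _ _ _ _ _)) => q /dis n e; clear -e n; intuition auto.
have c2 : commute f x by apply: (supported_commute sf (@supported_cyc _ _ _ _ _ _ _)) => q /dis n e; clear -e n; intuition auto.
have c3' : commute f f by [].
rewrite E2 (comm_mull _ (commute_mul c1 c3')) (comm_mulr _ c2).
rewrite cyc_comm //; try (apply: piece_sep; neq).
have -> : (fun z => on A z && on A z)%bool = on A.
  by apply: functional_extensionality => y; case: (on A y).
move=> /= K1.
(* The commutator is the cycle through [piece p w], l and 5. Conjugating it by (5 m 9) puts m in the
   place of 5 and gives x; dividing by x then gives f. *)
suff Kx : K x by split; [|exact: (sub_cancell K_subgroup Kx Kxf)].
have t1 : triple (piece p w) (L l) (L 5) by apply: piece_triple; neq.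
have K2 : K (c3 5 m 9 full) by apply: K_c3_all; try neq; apply: lt; clear; lia.
by apply: (N_conj K_normalized t1 K2 _ _ _ K1) => y; [apply: c3_0|apply: c3_0|apply: c3_1]; neq.
Qed.

(** After division by the letter cycle (0 1 3), the 3-cycles are split off [rest] one at a time;
    what remains each time lives on higher letters, away from 5, 7, 9 and 11. *)
Lemma K_parts : (K mix0 /\ K mix1) /\ (K (c3 18 20 22 A0) /\ K (along_letters 24 gens)).
Proof.
have dge := letters_ge.
have K0 : K rest by apply: (sub_cancell K_subgroup _ gen_a_in_K); apply: K_c3_all; lia.
have sG := @along_letters_supported 24 gens.
have s2 : supported (fun q => 18 <= q) (c3 18 20 22 A0 ** along_letters 24 gens).
  apply: supported_mono; first by apply: supported_mul sG; exact: supported_cyc.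
  by move=> q [|[i []]]; lia.
have s1 : supported (fun q => 12 <= q) (mix1 ** (c3 18 20 22 A0 ** along_letters 24 gens)).
  by apply: supported_mono; [apply: supported_mul s2; exact: supported_cyc|move=> q /=; lia].
have sG' : supported (fun q => 24 <= q) (along_letters 24 gens).
  by apply: supported_mono sG _ => q [i []]; lia.
have [Km0 K1] : K mix0 /\ K (mix1 ** (c3 18 20 22 A0 ** along_letters 24 gens)).
  by apply: (isolate _ _ _ s1 _ _ K0); try lia; [move=> q /= lt; lia|ndup].
have [Km1 K2] : K mix1 /\ K (c3 18 20 22 A0 ** along_letters 24 gens).
  by apply: (isolate _ _ _ s2 _ _ K1); try lia; [move=> q /= lt; lia|ndup].
have [Km2 K3] : K (c3 18 20 22 A0) /\ K (along_letters 24 gens).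
  by apply: (isolate _ _ _ sG' _ _ K2); try lia; [move=> q /= lt; lia|ndup].
by [].
Qed.

(** * 3-cycles of words *)

Lemma N_letter N (nN : normalized_by K N) p q s v w r u A : p < letters -> s < letters ->
  p <> q -> q <> r -> r <> p -> s <> p -> s <> q -> s <> r ->
  N (cyc (piece p w) (piece q v) (piece r u) A) -> N (cyc (piece s w) (piece q v) (piece r u) A).
Proof.
move=> pd sd pq qr rp sp sq sr Nc.
have [f [fd nf]] := @fresh [p; q; r; s] ltac:(simpl; lia).
split_neq.
have Kh : K (c3 p s f full) by apply: K_c3_all; neq.
apply: (N_conj nN (piece_triple w v u pq qr rp) Kh _ _ _ Nc) => x.
- by apply: c3_1; neq.
- by apply: c3_0; neq.
- by apply: c3_0; neq.
Qed.

Lemma piece_triple_rot_N N p q r u v w A : p <> q -> q <> r -> r <> p ->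
  N (cyc (piece p u) (piece q v) (piece r w) A) -> N (cyc (piece q v) (piece r w) (piece p u) A).
Proof. by move=> *; rewrite -cyc_rot //; exact: piece_triple. Qed.

Lemma K_bit p q r i : p < letters -> q < letters -> r < letters -> p <> q -> q <> r -> r <> p ->
  K (cyc (piece p [i]) (L q) (L r) (on full)).
Proof.
move=> pd qd rd pq qr rp.
have [s [l [m [K0 [sd [ld [md nd]]]]]]] : exists s l m, K (cyc (piece s [i]) (L l) (L m) (on full)) /\
    s < letters /\ l < letters /\ m < letters /\ NoDup [s; l; m].
  have [[Km0 Km1] _] := K_parts; have dge := letters_ge.
  case: i; [exists 12, 14, 16|exists 6, 8, 10]; do ?split => //; try lia; ndup.
rewrite !NoDup_cons_iff in nd.
(* The source letters s, l, m may overlap the targets p, q, r, so the cycle is first moved to fresh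
   letters. *)
have [f1 [f1d n1]] := @fresh [s; l; m; p; q; r] ltac:(simpl; lia).
have [f2 [f2d n2]] := @fresh [s; l; m; p; q; r; f1] ltac:(simpl; lia).
have [f3 [f3d n3]] := @fresh [s; l; m; p; q; r; f1; f2] ltac:(simpl; lia).
split_neq.
have lt := N_letter K_normalized.
have rot := @piece_triple_rot_N K.
have K1 : K (cyc (piece f1 [i]) (L f2) (L f3) (on full)).
  apply: (lt s); try neq; do 2?[apply: (rot); try neq].
  apply: (lt l); try neq; do 2?[apply: (rot); try neq].
  by apply: (lt m); try neq; do 2?[apply: (rot); try neq].
apply: (lt f1); try neq; do 2?[apply: (rot); try neq].
apply: (lt f2); try neq; do 2?[apply: (rot); try neq].
by apply: (lt f3); try neq; do 2?[apply: (rot); try neq].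
Qed.

Lemma piece_app p v w x : piece p (v ++ w) x = piece p v (prepend w x).
Proof. by rewrite /piece prepend_app. Qed.

Lemma cyc_prefix p q r v w x : p <> q -> q <> r -> r <> p ->
  (cyc (L q) (piece p v) (L r) (on full) : perm X) (piece q w x) = piece p (v ++ w) x.
Proof.
move=> pq qr rp; rewrite piece_app.
by have := cyc1 (on full) (piece_triple [] v [] (not_eq_sym pq) (not_eq_sym rp) (not_eq_sym qr)) (prepend w x).
Qed.

(** Induction on the word: a cycle carrying the letter f to the half [piece p [i]] conjugates a
    cycle starting at f w to one starting at p i w. *)
Lemma K_word p w q r : p < letters -> q < letters -> r < letters -> p <> q -> q <> r -> r <> p ->
  K (cyc (piece p w) (L q) (L r) (on full)).
Proof.
elim: w p => [|i w IH] p pd qd rd pq qr rp; first exact: K_c3_all.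
have [f [fd nf]] := @fresh [p; q; r] ltac:(simpl; lia).
have [g [gd ng]] := @fresh [p; q; r; f] ltac:(simpl; lia).
split_neq.
have Kh : K (cyc (L f) (piece p [i]) (L g) (on full)).
  do 2?[apply: piece_triple_rot_N; try neq]; rewrite -cyc_inv; first by apply: piece_triple; neq.
  by apply: (subV K_subgroup); apply: K_bit; neq.
have t : triple (piece f w) (L q) (L r) by apply: piece_triple; neq.
apply: (N_conj K_normalized t Kh _ _ _ (IH f _ _ _ _ _ _)); try neq; move=> x.
- by apply: (@cyc_prefix p f g [i] w x); neq.
- by apply: cyc_off; neq.
- by apply: cyc_off; neq.
Qed.
Lemma triple_letter p q r l v w u : triple (piece p w) (piece q v) (piece r u) -> l <> q -> l <> r ->
  triple (L l) (piece q v) (piece r u).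
Proof.
by case=> _ i2 i3 _ s23 _ lq lr; split=> //; try exact: piece_inj; apply: piece_sep => //; exact: not_eq_sym.
Qed.

Section NormalTransfer.
Variable N : Sym X -> Prop.
Hypothesis nN : normalized_by K N.

(** The other two pieces may lie over the same letter p. Being separate from [piece p w], they are
    fixed by the cycle through [piece p w], l and a fresh letter, which serves as the conjugator. *)
Lemma N_to_letter p q r l v w u A : triple (piece p w) (piece q v) (piece r u) ->
  p < letters -> l < letters -> l <> p -> l <> q -> l <> r ->
  N (cyc (piece p w) (piece q v) (piece r u) A) -> N (cyc (L l) (piece q v) (piece r u) A).
Proof.
move=> t pd ld lp lq lr Nc.
have [f [fd nf]] := @fresh [p; q; r; l] ltac:(simpl; lia); split_neq.
have Kh : K (cyc (piece p w) (L l) (L f) (on full)) by apply: K_word; neq.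
have t' : triple (piece p w) (L l) (L f) by apply: piece_triple; neq.
have [_ _ _ s12 _ s31] := t.
apply: (N_conj nN t Kh _ _ _ Nc) => x; first by rewrite (cyc1 (on full) t').
- by apply: (cyc_sep _ t'); [exact: separate_sym|apply: piece_sep; neq|apply: piece_sep; neq].
- by apply: (cyc_sep _ t'); [|apply: piece_sep; neq|apply: piece_sep; neq].
Qed.

Lemma N_of_letter p q r l v w u A : triple (piece p w) (piece q v) (piece r u) ->
  p < letters -> l < letters -> l <> p -> l <> q -> l <> r ->
  N (cyc (L l) (piece q v) (piece r u) A) -> N (cyc (piece p w) (piece q v) (piece r u) A).
Proof.
move=> t pd ld lp lq lr Nc.
have [f [fd nf]] := @fresh [p; q; r; l] ltac:(simpl; lia); split_neq.
have t' : triple (L l) (piece p w) (L f) by apply: piece_triple; neq.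
have Kh : K (cyc (L l) (piece p w) (L f) (on full)).
  by rewrite (cyc_rot _ t'); apply: K_word; neq.
have [_ _ _ s12 _ s31] := t.
have t'' : triple (L l) (piece q v) (piece r u) by exact: triple_letter t lq lr.
apply: (N_conj nN t'' Kh _ _ _ Nc) => x; first by rewrite (cyc1 (on full) t').
- by apply: (cyc_sep _ t'); [apply: piece_sep; neq|exact: separate_sym|apply: piece_sep; neq].
- by apply: (cyc_sep _ t'); [apply: piece_sep; neq| |apply: piece_sep; neq].
Qed.

Lemma N_to_letters p q r l m n v w u A : triple (piece p w) (piece q v) (piece r u) ->
  p < letters -> q < letters -> r < letters -> l < letters -> m < letters -> n < letters -> NoDup [l; m; n] ->
  ~ In l [p; q; r] -> ~ In m [p; q; r] -> ~ In n [p; q; r] ->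
  (N (cyc (piece p w) (piece q v) (piece r u) A) <-> N (cyc (L l) (L m) (L n) A)).
Proof.
move=> t pd qd rd ld md nd; rewrite !NoDup_cons_iff => ndup lN mN nN'; split_neq.
have t1 : triple (L l) (piece q v) (piece r u) by apply: triple_letter t _ _; neq.
have t1' := triple_rot t1.
have t2 : triple (L m) (piece r u) (L l) by apply: triple_letter t1' _ _; neq.
have t2' := triple_rot t2.
have t3 : triple (L n) (L l) (L m) by apply: triple_letter t2' _ _; neq.
rewrite -(cyc_rot _ t3); split.
  move=> Nc; apply: (N_to_letter t2'); try neq.
  rewrite -(cyc_rot _ t2); apply: (N_to_letter t1'); try neq.
  by rewrite -(cyc_rot _ t1); apply: (N_to_letter t); try neq.
move=> Nc; apply: (N_of_letter (l := l) t); try neq.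
rewrite (cyc_rot _ t1); apply: (N_of_letter (l := m) t1'); try neq.
by rewrite (cyc_rot _ t2); apply: (N_of_letter (l := n) t2'); try neq.
Qed.

(** Both 3-cycles are conjugate under K to the same cycle of three letters that are fresh for all
    six pieces. *)
Lemma N_transfer p q r v w u p' q' r' v' w' u' A :
  triple (piece p w) (piece q v) (piece r u) -> triple (piece p' w') (piece q' v') (piece r' u') ->
  p < letters -> q < letters -> r < letters -> p' < letters -> q' < letters -> r' < letters ->
  N (cyc (piece p w) (piece q v) (piece r u) A) -> N (cyc (piece p' w') (piece q' v') (piece r' u') A).
Proof.
move=> t t' pd qd rd pd' qd' rd'.
have [l [ld n1]] := @fresh [p; q; r; p'; q'; r'] ltac:(simpl; lia).
have [m [md n2]] := @fresh [p; q; r; p'; q'; r'; l] ltac:(simpl; lia).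
have [n [nd n3]] := @fresh [p; q; r; p'; q'; r'; l; m] ltac:(simpl; lia).
cbn [In] in n1, n2, n3.
have nodup : NoDup [l; m; n].
  by clear -n1 n2 n3; split_neq; repeat apply: NoDup_cons; try exact: NoDup_nil;
    cbn [In] => nin; intuition auto.
move=> Nc; apply: (proj2 (N_to_letters A t' pd' qd' rd' ld md nd nodup _ _ _)).
1-3: by clear -n1 n2 n3; cbn [In]; tauto.
apply: (proj1 (N_to_letters A t pd qd rd ld md nd nodup _ _ _) Nc).
all: by clear -n1 n2 n3; cbn [In]; tauto.
Qed.

End NormalTransfer.

(** * Restricted 3-cycles and actions over one letter *)

Definition allows (A : Y -> bool) := forall p q r v w u,
  triple (piece p w) (piece q v) (piece r u) -> p < letters -> q < letters -> r < letters ->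
  K (cyc (piece p w) (piece q v) (piece r u) (on A)).

Lemma allowsI p q r A : p <> q -> q <> r -> r <> p -> p < letters -> q < letters -> r < letters ->
  K (c3 p q r A) -> allows A.
Proof.
move=> pq qr rp pd qd rd Kc p' q' r' v w u t' pd' qd' rd'.
by apply: (N_transfer K_normalized (piece_triple [] [] [] pq qr rp) t').
Qed.

Lemma lt_letters n : n < 31 -> n < letters.
Proof. by have := letters_ge; lia. Qed.

Ltac num := first [done | by apply: lt_letters; lia | lia].

Lemma allows_full : allows full.
Proof. by apply: (@allowsI 0 1 2); try num; exact: K_c3_012. Qed.

Lemma allows_A0 : allows A0.
Proof. by apply: (@allowsI 18 20 22); try num; have [_ []] := K_parts. Qed.

(** The commutator of two 3-cycles sharing one letter is restricted to the intersection of their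
    conditions. *)
Lemma allows_and A B : allows A -> allows B -> allows (fun y => A y && B y)%bool.
Proof.
move=> KA KB; apply: (@allowsI 0 1 3); try num.
have -> : c3 0 1 3 (fun y => A y && B y)%bool = comm (c3 0 1 2 A) (c3 0 3 4 B).
  by rewrite /c3 cyc_comm //; try (by apply: piece_triple; lia); apply: piece_sep; lia.
by apply: (sub_comm K_subgroup); [apply: KA|apply: KB]; try num; apply: piece_triple; lia.
Qed.

Lemma cyc_compl e1 e2 e3 (A : Y -> bool) : triple e1 e2 e3 ->
  cyc e1 e2 e3 (on full) = cyc e1 e2 e3 (on A) ** cyc e1 e2 e3 (on (fun y => negb (A y))) :> Sym X.
Proof.
move=> t; have dis x : on A x = true -> on (fun y => negb (A y)) x = false by rewrite /on => ->.
rewrite -(cyc_disjoint_union t dis).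
by congr cyc; apply: functional_extensionality => x; rewrite /on; case: (A _).
Qed.

Lemma allows_neg A : allows A -> allows (fun y => negb (A y)).
Proof.
move=> KA; apply: (@allowsI 0 1 2); try num.
have t : triple (L 0) (L 1) (L 2) by apply: piece_triple.
apply: (sub_cancell K_subgroup (x := c3 0 1 2 A)); first by apply: KA => //; num.
by rewrite /c3 -cyc_compl //; exact: K_c3_012.
Qed.

Definition spreads (s : perm Y) := forall p, p < letters -> K (at_piece (L p) (lift s)).

Lemma lift_prepend s w x : lift s (prepend w x) = prepend w (lift s x).
Proof. by elim: w => [//|i w IH]; rewrite /= -IH. Qed.

(** Conjugation by the element acting as s over p, q and r simultaneously preserves these letters
    and transports A. *)
Lemma c3_translate N (nN : normalized_by K N) s p q r A : spreads s ->
  p < letters -> q < letters -> r < letters -> p <> q -> q <> r -> r <> p ->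
  N (c3 p q r A) -> N (c3 p q r (fun y => A (bwd s y))).
Proof.
move=> Ks pd qd rd pq qr rp Nc.
pose h := at_piece (L p) (lift s) ** (at_piece (L q) (lift s) ** at_piece (L r) (lift s)).
have Kh : K h by do 2?[apply: (subM K_subgroup)]; exact: Ks.
have ev l x : (at_piece (L l) (lift s) : perm X) (l, x) = (l, lift s x).
  by have := atE (lift s) (@piece_inj l []) x.
have off l m x : l <> m -> (at_piece (L l) (lift s) : perm X) (m, x) = (m, x).
  by move=> lm; apply: supported_at; exact: not_eq_sym.
have hE l x : l = p \/ l = q \/ l = r -> (h : perm X) (L l x) = L l (lift s x).
  have hh y : (h : perm X) y = (at_piece (L p) (lift s) : perm X)
    ((at_piece (L q) (lift s) : perm X) ((at_piece (L r) (lift s) : perm X) y)) by [].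
  by rewrite hh => -[->|[->|->]];
    [rewrite (off r p) ?(off q p) ?ev //|rewrite (off r q) ?ev ?(off p q) //|rewrite ev ?(off q r) ?(off p r) //];
    exact: not_eq_sym.
have t := piece_triple [] [] [] pq qr rp.
have [_ ] := @cyc_conj D X h (lift s) (L p) (L q) (L r) (L p) (L q) (L r) (on A) t
  (fun x => hE p x (or_introl eq_refl)) (fun x => hE q x (or_intror (or_introl eq_refl)))
  (fun x => hE r x (or_intror (or_intror eq_refl))).
by rewrite /c3 => <-; exact: nN.
Qed.
Lemma split_stream (x : D) : exists i y, x = cons_bit i y.
Proof.
case: x => z y; exists (z 0), (fun n => z (S n), y).
by rewrite /cons_bit /=; congr pair; apply: functional_extensionality => -[|n].
Qed.

(** The source of x = 2x: to act over a letter is to act over both of its halves. *)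
Lemma at_split q s :
  at_piece (L q) (lift s) = at_piece (piece q [true]) (lift s) ** at_piece (piece q [false]) (lift s).
Proof.
symmetry; apply: at_uniq; first exact: piece_inj.
  move=> x; have [i [y ->]] := split_stream x.
  have sep : separate (piece q [true]) (piece q [false]) by exact: piece_sep_words.
  have e j z : (L q) (cons_bit j z) = piece q [j] z by [].
  have ls : lift s (cons_bit i y) = cons_bit i (lift s y) by exact: (lift_prepend s [i] y).
  rewrite ls !e; case: i {ls} => /=.
    by rewrite (at_sep _ (@piece_inj q _) sep) atE //; exact: piece_inj.
  by rewrite atE ?(at_sep _ (@piece_inj q _) (separate_sym sep)) //; exact: piece_inj.
by move=> [r x] n; rewrite /= !at0 //; try exact: piece_inj; move=> y [e _];
  apply: (n x); rewrite /piece /= e.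
Qed.

(* Moving q to q0 in the hypothesis and dividing leaves s acting on q1, as s on q is s on q0 times s on q1. *)
Lemma at_cancel H s p q r : is_subgroup H ->
  (forall p q r v w u, p < letters -> q < letters -> r < letters -> p <> q -> q <> r -> r <> p ->
    H (cyc (piece p w) (piece q v) (piece r u) (on full))) ->
  p < letters -> q < letters -> p <> q -> r < letters ->
  H (at_piece (L p) (lift s) ** (at_piece (L q) (lift s))^-1) -> H (at_piece (L r) (lift s)).
Proof.
move=> sH Hc pd qd pq rd Hpq.
have [f [fd nf]] := @fresh [p; q; r] ltac:(simpl; lia).
have [g [gd ng]] := @fresh [p; q; r; f] ltac:(simpl; lia); split_neq.
set A := at_piece (L p) _ in Hpq; set B := at_piece (L q) _ in Hpq.
have conj e e' h : injective e -> H h -> (forall x, (h : perm X) (e x) = e' x) ->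
    H (at_piece e (lift s)) -> H (at_piece e' (lift s)).
  by move=> i Hh E /(sub_conj sH Hh); have [_ ->] := at_conj (lift s) i E.
have Hbit : H (at_piece (piece q [true]) (lift s)).
  (* Carries q to f and then to the half q0, and fixes p. *)
  pose h := cyc (L f) (piece q [false]) (L g) (on full) ** c3 q f g full.
  have t : triple (L f) (piece q [false]) (L g) by apply: piece_triple; neq.
  have Hh : H h by apply: (subM sH); apply: Hc; neq.
  have hq x : (h : perm X) (L q x) = piece q [false] x.
    have -> : (h : perm X) (L q x) =
      (cyc (L f) (piece q [false]) (L g) (on full) : perm X) ((c3 q f g full : perm X) (q, x)) by [].
    by rewrite c3_1; try neq; rewrite (cyc1 (on full) t).
  have hp x : (h : perm X) (L p x) = L p x.
    have -> : (h : perm X) (L p x) =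
      (cyc (L f) (piece q [false]) (L g) (on full) : perm X) ((c3 q f g full : perm X) (p, x)) by [].
    by rewrite c3_0; try neq; apply: cyc_off; neq.
  have [_ EA] := at_conj (lift s) (@piece_inj p []) hp.
  have [_ EB] := at_conj (lift s) (@piece_inj q []) hq.
  have := sub_conj sH Hh Hpq.
  have -> : h ** (A ** B^-1) ** h^-1 = A ** (at_piece (piece q [false]) (lift s))^-1.
    by rewrite conj_div EA EB.
  (* The quotient is s on q times the inverse of s on q0, that is, s on q1. *)
  move=> /(subM sH (subV sH Hpq)).
  by rewrite ginv_mul ginvK !gmul_assoc gmulVK /B at_split gmulKV.
have tr x : x < letters -> x <> q -> H (at_piece (L x) (lift s)).
  move=> xd xq; have [y [yd ny]] := @fresh [q; x] ltac:(simpl; lia); split_neq.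
  have t : triple (piece q [true]) (L x) (L y) by apply: piece_triple; neq.
  apply: (conj _ _ _ (@piece_inj q [true]) (Hc q x y [] [true] [] _ _ _ _ _ _)) Hbit; try neq.
  by move=> z; rewrite (cyc1 (on full) t).
case: (Nat.eq_dec r q) => [->|n]; last exact: tr.
apply: (conj _ _ _ (@piece_inj f []) (Hc f q g [] [] [] _ _ _ _ _ _)) (tr f _ _); try neq.
by move=> z; apply: c3_1; neq.
Qed.

Lemma K_cyc_words p q r v w u : p < letters -> q < letters -> r < letters -> p <> q -> q <> r -> r <> p ->
  K (cyc (piece p w) (piece q v) (piece r u) (on full)).
Proof. by move=> *; apply: allows_full => //; exact: piece_triple. Qed.

Lemma comm_at p q (t : perm D) (h : Sym X) :
  (forall x, (h : perm X) (L p x) = L q x) ->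
  comm (at_piece (L p) t) h = at_piece (L p) t ** (at_piece (L q) t)^-1.
Proof.
move=> E; have [_ <-] := at_conj t (@piece_inj p []) E.
by rewrite /comm !ginv_mul ginvK !gmul_assoc.
Qed.

(** The cycle (j 5 7) commutes with the factors on later letters, so its commutator with the product
    involves only the factor at j; [at_cancel] extracts s, and division by that factor leaves the
    rest of the list. *)
Lemma spreads_along_letters l j : 24 <= j -> j + 2 * length l < letters -> K (along_letters j l) ->
  forall s, In s l -> spreads s.
Proof.
elim: l j => [//|s l IH] j ge lt KG s' ins; cbn [length] in lt.
have Ks : spreads s.
  have Kh : K (c3 j 5 7 full) by apply: K_c3_all; try num; lia.
  have c : commute (along_letters (j + 2) l) (c3 j 5 7 full).
    apply: (supported_commute (@along_letters_supported (j + 2) l) (@supported_cyc j 5 7 [] [] [] (on full))).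
    by move=> q [i []]; lia.
  have := sub_comm K_subgroup KG Kh; rewrite (comm_mull _ c).
  rewrite (comm_at (q := 5)) => [x|Kat]; first by apply: c3_1; lia.
  by move=> r rd; apply: (at_cancel K_subgroup K_cyc_words _ _ _ rd Kat); try num; lia.
case: ins => [<- //|ins]; apply: (IH (j + 2)) => //; try lia.
by apply: (sub_cancell K_subgroup _ KG); apply: Ks; lia.
Qed.

Lemma spreads_gens s : In s gens -> spreads s.
Proof.
have [_ [_ KG]] := K_parts; apply: (spreads_along_letters _ _ KG); rewrite /letters /half; lia.
Qed.

Lemma lift_mul s t : lift (perm_mul s t) = perm_mul (lift s) (lift t).
Proof. exact: perm_ext. Qed.

Lemma lift_inv s : lift (perm_inv s) = perm_inv (lift s).
Proof. exact: perm_ext. Qed.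

Lemma spreads_mul s t : spreads s -> spreads t -> spreads (perm_mul s t).
Proof.
move=> Ks Kt p pd; rewrite lift_mul at_mul; first exact: piece_inj.
by apply: (subM K_subgroup); [exact: Ks|exact: Kt].
Qed.

Lemma spreads_inv s : spreads s -> spreads (perm_inv s).
Proof.
move=> Ks p pd; rewrite lift_inv at_inv; first exact: piece_inj.
by apply: (subV K_subgroup); exact: Ks.
Qed.

Lemma spreads_one : spreads (perm_one Y).
Proof.
move=> p pd; have -> : at_piece (L p) (lift (perm_one Y)) = gone; last exact: (sub1 K_subgroup).
by symmetry; apply: at_uniq => [|[z y]|]; first exact: piece_inj.
Qed.

(** Induction principle: both generators are products of such 3-cycles and of actions over one
    letter, so a subgroup containing these contains K. *)
Lemma K_min P : is_subgroup P ->
  (forall p q r v w u A, p < letters -> q < letters -> r < letters -> p <> q -> q <> r -> r <> p ->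
    A = full \/ A = A0 -> P (cyc (piece p w) (piece q v) (piece r u) (on A))) ->
  (forall p s, p < letters -> In s gens -> P (at_piece (L p) (lift s))) ->
  forall f, K f -> P f.
Proof.
move=> sP Pc Pat; apply: generated_min => // f.
have Pb n : n <= half -> P (brot n).
  elim: n => [|n IH] le; first exact: (sub1 sP).
  apply: (subM sP); first by apply: IH; lia.
  by apply: Pc; rewrite /letters; auto; lia.
have PG l j : j + 2 * length l < letters -> incl l gens -> P (along_letters j l).
  elim: l j => [|s l IH] j lt inc; first exact: (sub1 sP).
  cbn [length] in lt; apply: (subM sP); first by apply: Pat; [lia|apply: inc; left].
  by apply: IH; [lia|move=> t it; apply: inc; right].
case=> ->; last exact: Pb.
do 4?[apply: (subM sP)]; try by apply: Pc; try num; auto.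
by apply: PG => //; rewrite /letters /half; lia.
Qed.

(** * Normal closures in K *)

Section Simple.
Variable N : Sym X -> Prop.
Hypothesis sN : is_subgroup N.
Hypothesis nN : normalized_by K N.

(** Commutators with elements of K do the work: an [A0]-restricted cycle is the commutator of an
    unrestricted cycle with another cycle of K, and the commutator of s over a letter with a 3-cycle
    feeds [at_cancel] inside N. *)
Lemma N_everything p q r : p < letters -> q < letters -> r < letters -> p <> q -> q <> r -> r <> p ->
  N (c3 p q r full) -> forall f, K f -> N f.
Proof.
move=> pd qd rd pq qr rp Nc.
have Nf p' q' r' v w u : p' < letters -> q' < letters -> r' < letters -> p' <> q' -> q' <> r' -> r' <> p' ->
    N (cyc (piece p' w) (piece q' v) (piece r' u) (on full)).
  by move=> *; apply: (N_transfer nN (piece_triple [] [] [] pq qr rp) _ pd qd rd) => //; exact: piece_triple.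
apply: K_min => // [p' q' r' v w u A p'd q'd r'd p'q' q'r' r'p' [->|->]|p' s p'd ins].
- exact: Nf.
- have : N (c3 0 1 3 A0).
    have -> : c3 0 1 3 A0 = comm (c3 0 1 2 full) (c3 0 3 4 A0).
      by rewrite /c3 cyc_comm //; try (by apply: piece_triple; lia); apply: piece_sep; lia.
    apply: (normal_comml sN K_subgroup nN); first by apply: Nf; num.
    by apply: allows_A0; try num; exact: piece_triple.
  have t : @triple D X (L 0) (L 1) (L 3) by apply: piece_triple.
  by apply: (N_transfer nN t) => //; try num; exact: piece_triple.
- have [x [xd nx]] := @fresh [p'] ltac:(simpl; lia).
  have [y [yd ny]] := @fresh [p'; x] ltac:(simpl; lia); split_neq.
  have Nh : N (c3 p' x y full) by apply: Nf; neq.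
  have := normal_commr sN nN (spreads_gens ins p'd) Nh.
  rewrite (comm_at (q := x)) => [z|Nat']; first by apply: c3_1; neq.
  by apply: (at_cancel sN Nf _ _ _ p'd Nat'); neq.
Qed.

(** Let U be the brick [piece p w] restricted to A. Cycles f and g supported in U commute with n f
    n^-1, which is supported in the disjoint image of U, so [normal_displaced] puts a 3-cycle in
    N. *)
Lemma N_of_displaced n p w A : N n -> p < letters -> allows A ->
  (forall x y, A (snd x) = true -> A (snd y) = true -> (n : perm X) (piece p w x) <> piece p w y) ->
  N (c3 0 1 2 A).
Proof.
move=> Nn pd KA disp.
(* Three further bits give eight disjoint subbricks; five are used, for two 3-cycles meeting only in
   e1. *)
pose e i j l := piece p (w ++ [i; j; l]).
have sep i j l i' j' l' : (i, j, l) <> (i', j', l') -> separate (e i j l) (e i' j' l').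
  by move=> ne; apply: piece_sep_app; apply: piece_sep_words => // -[] *; apply: ne; congruence.
have tri i j l i' j' l' i'' j'' l'' : (i, j, l) <> (i', j', l') -> (i', j', l') <> (i'', j'', l'') ->
    (i'', j'', l'') <> (i, j, l) -> triple (e i j l) (e i' j' l') (e i'' j'' l'').
  by move=> *; split; try exact: piece_inj; exact: sep.
pose e1 := e true true true; pose e2 := e true true false; pose e3 := e true false true.
pose e4 := e true false false; pose e5 := e false true true.
have t : triple e1 e2 e3 by exact: tri.
have t' : triple e1 e4 e5 by exact: tri.
pose f := cyc e1 e2 e3 (on A); pose g := cyc e1 e4 e5 (on A).
have Kf : K f by apply: KA.
have Kg : K g by apply: KA.
pose U x := exists y, A (snd y) = true /\ piece p w y = x.
have inU i j l y : on A y = true -> U (e i j l y).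
  move=> Ay; exists (prepend [i; j; l] y); rewrite /e piece_app; split=> //.
have fixU e' e'' e''' : triple e' e'' e''' -> (forall y, on A y = true -> U (e' y)) ->
    (forall y, on A y = true -> U (e'' y)) -> (forall y, on A y = true -> U (e''' y)) ->
    forall x, ~ U x -> (cyc e' e'' e''' (on A) : perm X) x = x.
  move=> tt u u' u'' x nU; apply: cyc_fix => // y Ay.
  by split; [|split]; move=> E; apply: nU; rewrite -E; auto.
have ff x : ~ U x -> (f : perm X) x = x by apply: fixU => // *; exact: inU.
have fg x : ~ U x -> (g : perm X) x = x by apply: fixU => // *; exact: inU.
have nf x : U x -> (n ** f ** n^-1 : perm X) x = x.
  move=> [y [Ay E]]; rewrite /= ff ?bwdK // => -[y' [Ay' E']].
  by apply: (disp y' y Ay' Ay); rewrite E' E bwdK.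
have cm h : (forall x, ~ U x -> (h : perm X) x = x) -> commute (n ** f ** n^-1) h.
  by move=> hU; apply: disjoint_commute => x; case: (classic (U x)) => Ux; [left; exact: nf|right; exact: hU].
have := normal_displaced sN K_subgroup nN Nn Kf Kg (cm f ff) (cm g fg).
rewrite cyc_inv // cyc_comm //; try exact: sep; first exact: triple_swap.
have -> : (fun x => on A x && on A x)%bool = on A.
  by apply: functional_extensionality => y; case: (on A y).
have t1 : triple e1 e3 e4 by exact: tri.
have t2 : @triple D X (L 0) (L 1) (L 2) by apply: piece_triple.
by apply: (N_transfer nN t1 t2) => //; num.
Qed.

End Simple.

Lemma K_large f p x : K f -> letters <= p -> (f : perm X) (p, x) = (p, x).
Proof.
move=> Kf pd.
suff : forall f, K f -> forall q x, letters <= q -> (f : perm X) (q, x) = (q, x) by move=> H; exact: H.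
apply: K_min => [|p' q r v w u A p'd qd rd _ _ _ _ s y sd|p' s p'd _ q y qd].
- split=> [//|g h Hg Hh q y qd|g Hg q y qd] /=; first by rewrite Hh ?Hg.
  by rewrite -{1}(Hg q y qd) fwdK.
- by apply: cyc_off; lia.
- by apply: supported_at; lia.
Qed.

End TwoGenerators.

(** * Configurations and simplicity *)

Section Configurations.
Variables (Q : Group) (SQ : list Q).
Hypothesis gSQ : forall q, generated (fun s => In s SQ) q.

Definition Y : Type := Q -> bool.
Notation D := (D Y).
Notation X := (X Y).

Definition act (q : Q) : perm Y.
Proof.
refine (@Perm _ (fun (y : Y) r => y (q^-1 ** r)) (fun (y : Y) r => y (q ** r)) _ _).
- by move=> y; apply: functional_extensionality => r; rewrite gmul_assoc gmul_inv_l gmul_one_l.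
- by move=> y; apply: functional_extensionality => r; rewrite gmul_assoc gmul_inv_r gmul_one_l.
Defined.

Definition flip_fun (q : Q) (y : Y) : Y :=
  fun r => match excluded_middle_informative (r = q) with left _ => negb (y r) | right _ => y r end.

Lemma flip_funK q y : flip_fun q (flip_fun q y) = y.
Proof.
apply: functional_extensionality => r; rewrite /flip_fun.
by case: excluded_middle_informative => // _; case: (y r).
Qed.

Definition flip (q : Q) : perm Y := Perm (flip_funK q) (flip_funK q).

Definition A0 (y : Y) : bool := y gone.
Definition gens : list (perm Y) := flip gone :: map act SQ.

Notation K := (K A0 gens).
Notation letters := (letters gens).
Notation allows := (allows A0 gens).
Notation spreads := (spreads A0 gens).
Notation piece := (@piece Y).
Notation L p := (piece p []).
Notation full := (@full Y).

Lemma act_mul q r : act (q ** r) = perm_mul (act q) (act r).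
Proof.
apply: perm_ext => y; apply: functional_extensionality => s /=.
by rewrite ginv_mul gmul_assoc.
Qed.

Lemma act_inv q : act (q^-1) = perm_inv (act q).
Proof. by apply: perm_ext => y; apply: functional_extensionality => s /=; rewrite ginvK. Qed.

Lemma act_one : act gone = perm_one Y.
Proof.
by apply: perm_ext => y; apply: functional_extensionality => s /=; rewrite ginv1 gmul_one_l.
Qed.

Lemma spreads_act q : spreads (act q).
Proof.
elim: (gSQ q) => {q} [q Sq||q r _ IHq _ IHr|q _ IH].
- by apply: spreads_gens; right; exact: in_map.
- by rewrite act_one; exact: spreads_one.
- by rewrite act_mul; exact: spreads_mul.
- by rewrite act_inv; exact: spreads_inv.
Qed.

(** The flip at q is the flip at the identity conjugated by the translation by q. *)
Lemma spreads_flip q : spreads (flip q).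
Proof.
have -> : flip q = perm_mul (act q) (perm_mul (flip gone) (act (q^-1))).
  apply: perm_ext => y; apply: functional_extensionality => r /=; rewrite /flip_fun ginvK.
  rewrite gmul_assoc gmul_inv_r gmul_one_l.
  case: excluded_middle_informative => [->|n]; case: excluded_middle_informative => //.
    by rewrite gmul_inv_l.
  by move=> e; case: n; apply: (@gmulI _ (q^-1)); rewrite e gmul_inv_l.
apply: spreads_mul; first exact: spreads_act.
apply: spreads_mul; last exact: spreads_act.
by apply: spreads_gens; left.
Qed.

Lemma allows_coord q : allows (fun y => y q).
Proof.
apply: (@allowsI Y A0 gens 0 1 2) => //; try exact: lt_letters; try (apply: lt_letters; lia).
have K0 : K (c3 0 1 2 A0) by apply: allows_A0; try (apply: lt_letters; lia); exact: piece_triple.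
have := c3_translate (@K_normalized Y A0 gens) (spreads_act q) _ _ _ _ _ _ K0.
rewrite /A0 /= gmul_one_r; apply; try (apply: lt_letters; lia); lia.
Qed.

Definition cyl (F : list Q) (y0 y : Y) : bool := forallb (fun q => Bool.eqb (y q) (y0 q)) F.

Lemma cylP F y0 y : cyl F y0 y = true <-> forall q, In q F -> y q = y0 q.
Proof.
rewrite /cyl forallb_forall; split=> H q /H; first exact: Bool.eqb_prop.
by move=> ->; exact: Bool.eqb_reflx.
Qed.

Lemma allows_ext A B : A = B -> allows A -> allows B.
Proof. by move=> ->. Qed.

Lemma allows_cyl F y0 : allows (cyl F y0).
Proof.
elim: F => [|q F IH]; first exact: allows_full.
apply: allows_and IH; case: (y0 q).
  by apply: (allows_ext _ (allows_coord q)); apply: functional_extensionality => y; case: (y q).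
apply: (allows_ext _ (allows_neg (allows_coord q))).
by apply: functional_extensionality => y; case: (y q).
Qed.

Section Normal.
Variable N : Sym X -> Prop.
Hypothesis sN : is_subgroup N.
Hypothesis nN : normalized_by K N.

(** Coordinates are removed one at a time: the flip at q exchanges the two halves of a cylinder
    determined by the value at q, so a cycle over one half times its conjugate is the cycle over the
    whole cylinder. *)
Lemma N_cyl_full F y0 : N (c3 0 1 2 (cyl F y0)) -> N (c3 0 1 2 full).
Proof.
elim: F => [//|q F IH] Nc; apply: IH.
(* A repeated coordinate imposes no new condition and is dropped directly. *)
case: (classic (In q F)) => qF.
  have <- : cyl (q :: F) y0 = cyl F y0; last exact: Nc.
  apply: functional_extensionality => y; rewrite [LHS]/cyl /= -/(cyl F y0 y).
  case E: (cyl F y0 y); rewrite ?Bool.andb_false_r // Bool.andb_true_r.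
  by rewrite (proj1 (cylP _ _ _) E _ qF) Bool.eqb_reflx.
have Nc' := c3_translate nN (spreads_flip q) _ _ _ _ _ _ Nc.
have {}Nc' : N (c3 0 1 2 (fun y => cyl (q :: F) y0 (flip_fun q y))).
  by apply: Nc'; try (apply: lt_letters; lia); lia.
have := subM sN Nc Nc'.
have t : @triple D X (L 0) (L 1) (L 2) by apply: piece_triple.
have cF y : cyl F y0 (flip_fun q y) = cyl F y0 y.
  apply: Bool.eq_true_iff_eq; rewrite !cylP /flip_fun.
  split=> H r rF; move: (H r rF); case: excluded_middle_informative => // e; by subst r.
have cq y : flip_fun q y q = negb (y q).
  by rewrite /flip_fun; case: excluded_middle_informative.
rewrite /c3 -cyc_disjoint_union //.
  move=> x; rewrite /on /cyl /= -!/(cyl F y0 _) cF cq.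
  by case: (snd x q); case: (y0 q); case: (cyl _ _ _).
have -> // : (fun x => on (cyl (q :: F) y0) x || on (fun y => cyl (q :: F) y0 (flip_fun q y)) x)%bool
  = on (cyl F y0).
apply: functional_extensionality => x; rewrite /on /= -!/(cyl F y0 _) cF cq.
by case: (snd x q); case: (y0 q); case: (cyl _ _ _).
Qed.

End Normal.

(** * The product topology and continuity of K *)

Definition agree m (F : list Q) (x x' : D) :=
  (forall i, i < m -> fst x i = fst x' i) /\ (forall q, In q F -> snd x q = snd x' q).

Lemma agree_weaken m m' F F' x x' : m <= m' -> incl F F' -> agree m' F' x x' -> agree m F x x'.
Proof. by move=> le inc [a1 a2]; split=> [i lt|q /inc]; [apply: a1; lia|exact: a2]. Qed.

Definition nbhd (x : D) (U : D -> Prop) := exists m F, forall x', agree m F x x' -> U x'.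
Definition openD (U : D -> Prop) := forall x, U x -> nbhd x U.
Definition openX (U : X -> Prop) := forall p, openD (fun x => U (p, x)).

Lemma nbhd_and x U V : nbhd x U -> nbhd x V -> nbhd x (fun y => U y /\ V y).
Proof.
move=> [m [F HU]] [m' [F' HV]]; exists (m + m'), (F ++ F') => y a.
by split; [apply: HU|apply: HV]; apply: agree_weaken a; try lia;
  [apply: incl_appl|apply: incl_appr]; exact: incl_refl.
Qed.

Lemma nbhd_mono x (U V : D -> Prop) : (forall y, U y -> V y) -> nbhd x U -> nbhd x V.
Proof. by move=> UV [m [F H]]; exists m, F => y /H /UV. Qed.

Lemma agree_cons_bit i m F x y : agree m F x y -> agree (S m) F (cons_bit i x) (cons_bit i y).
Proof. by move=> [a1 a2]; split=> // -[|j] lt //=; apply: a1; lia. Qed.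

Lemma agree_prepend w m F x y : agree m F x y -> agree (length w + m) F (prepend w x) (prepend w y).
Proof. by move=> ag; elim: w => //= i w; exact: agree_cons_bit. Qed.

Lemma agree_cons_bit_inv i m F x y : agree (S m) F (cons_bit i x) y -> exists z, y = cons_bit i z /\ agree m F x z.
Proof.
have [j [z ->]] := split_stream y; move=> [a1 a2].
have e := a1 0 ltac:(lia); rewrite /= in e; subst j.
exists z; split=> //; split=> // j lt.
by have := a1 (S j) ltac:(lia).
Qed.

Lemma agree_prepend_inv w m F x y : agree (length w + m) F (prepend w x) y ->
  exists z, y = prepend w z /\ agree m F x z.
Proof.
elim: w y => [|i w IH] y /=; first by exists y.
by move=> /agree_cons_bit_inv [z [-> /IH [z' [-> ag]]]]; exists z'.
Qed.

Lemma nbhd_prepend w x U : nbhd x U -> nbhd (prepend w x) (fun y => exists z, y = prepend w z /\ U z).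
Proof.
move=> [m [F H]]; exists (length w + m), F => y /agree_prepend_inv [z [-> /H Uz]].
by exists z.
Qed.

Lemma open_piece p w U : openX U -> openD (fun x => U (piece p w x)).
Proof.
move=> oU x /oU [m [F H]]; exists m, F => y ag; apply: H.
by apply: agree_weaken (agree_prepend w ag); [lia|exact: incl_refl].
Qed.

Definition continuous (f : Sym X) := forall U, openX U -> openX (fun x => U ((f : perm X) x)).

Definition locally_constant (A : Y -> bool) :=
  forall x : D, nbhd x (fun x' => on A x' = on A x).

(** Membership in a piece is decided by the letter and the first [length w] bits, so the complement
    of a piece is open. *)
Lemma nbhd_off p w s x : (forall y, piece p w y <> (s, x)) ->
  nbhd x (fun x' => forall y, piece p w y <> (s, x')).
Proof.
move=> n; exists (length w), [] => x' ag y [e e']; subst p x'.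
have : agree (length w + 0) [] (prepend w y) x.
  by rewrite Nat.add_0_r; case: ag => a1 _; split=> // i lt; rewrite a1.
by move=> /agree_prepend_inv [z [e _]]; apply: (n z); rewrite /piece e.
Qed.

(** Treats the first piece only; the other two follow by rotating the cycle. *)
Lemma cyc_nbhd p q r u v w A U x : triple (piece p u) (piece q v) (piece r w) ->
  locally_constant A -> openX U ->
  U ((cyc (piece p u) (piece q v) (piece r w) (on A) : perm X) (piece p u x)) ->
  nbhd (prepend u x) (fun x' => U ((cyc (piece p u) (piece q v) (piece r w) (on A) : perm X) (p, x'))).
Proof.
move=> t lA oU; rewrite cyc1 // => Ux.
have H : nbhd x (fun y => U (if on A x then piece q v y else piece p u y)).
  by move: Ux; case: (on A x) => Ux; [exact: (@open_piece q v U oU x Ux)|exact: (@open_piece p u U oU x Ux)].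
apply: nbhd_mono (nbhd_prepend u (nbhd_and (lA x) H)) => y [z [-> [e Uz]]].
by rewrite -/(piece p u z) cyc1 // e.
Qed.

Lemma continuous_cyc p q r u v w A : triple (piece p u) (piece q v) (piece r w) ->
  locally_constant A -> continuous (cyc (piece p u) (piece q v) (piece r w) (on A)).
Proof.
move=> t lA U oU s x Ux.
have t' := triple_rot t; have t'' := triple_rot t'.
case: (classic (exists y, piece p u y = (s, x))) => [[y [e1 e2]]|n1].
  by subst s x; apply: cyc_nbhd.
case: (classic (exists y, piece q v y = (s, x))) => [[y [e1 e2]]|n2].
  by subst s x; move: Ux; rewrite (cyc_rot _ t); apply: cyc_nbhd.
case: (classic (exists y, piece r w y = (s, x))) => [[y [e1 e2]]|n3].
  by subst s x; move: Ux; rewrite (cyc_rot _ t) (cyc_rot _ t'); apply: cyc_nbhd.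
have off (e : D -> X) : ~ (exists y, e y = (s, x)) -> forall y, e y <> (s, x).
  by move=> n y E; apply: n; exists y.
rewrite cyc0 // in Ux; try exact: off.
have := nbhd_and (oU s x Ux) (nbhd_and (nbhd_off (off _ n1)) (nbhd_and (nbhd_off (off _ n2)) (nbhd_off (off _ n3)))).
by apply: nbhd_mono => y [Uy [o1 [o2 o3]]]; rewrite cyc0.
Qed.

(** Continuity on configurations in a uniform form: F' depends on F alone. *)
Definition finitary (s : perm Y) := forall F : list Q, exists F', forall y y',
  (forall q, In q F' -> y q = y' q) -> forall q, In q F -> s y q = s y' q.

Lemma continuous_at p s : finitary s -> continuous (at_piece (L p) (lift s)).
Proof.
move=> fs U oU r x Ux.
case: (classic (r = p)) => [e|n]; last first.
  move: Ux; rewrite supported_at // => Ux.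
  by apply: nbhd_mono (oU r x Ux) => y Uy; rewrite supported_at.
subst r; have atp y : (at_piece (L p) (lift s) : perm X) (p, y) = (p, lift s y).
  exact: (atE (lift s) (@piece_inj Y p []) y).
move: Ux; rewrite atp => /oU [m [F H]]; have [F' HF] := fs F.
exists m, F' => y [a1 a2]; rewrite atp; apply: H; split=> //=.
exact: HF.
Qed.

Lemma finitary_act q : finitary (act q).
Proof.
move=> F; exists (map (fun r => q^-1 ** r) F) => y y' H r rF /=.
by apply: H; exact: (in_map (fun r => q^-1 ** r)).
Qed.

Lemma finitary_flip q : finitary (flip q).
Proof. by move=> F; exists F => y y' H r rF; rewrite /= /flip_fun (H r rF). Qed.

Lemma K_continuous f : K f -> continuous f.
Proof.
(* The inverse is carried along so that the property is stable under inversion, as [K_min]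
   requires. *)
suff : forall f, K f -> continuous f /\ continuous (f^-1) by move=> H /H [].
apply: K_min => [|p q r v w u A pd qd rd pq qr rp EA|p s pd ins].
- split.
  + by rewrite ginv1; split=> U.
  + move=> g h [cg cg'] [ch ch']; rewrite ginv_mul; split=> U oU.
      by have := ch _ (cg _ oU).
    by have := cg' _ (ch' _ oU).
  + by move=> g [cg cg']; rewrite ginvK.
- have lA : locally_constant A.
    case: EA => -> x; first by exists 0, [].
    by exists 0, [gone] => y [_ a2]; rewrite /on /A0 (a2 gone) //; left.
  have t : triple (piece p w) (piece q v) (piece r u) by exact: piece_triple.
  rewrite (cyc_inv _ t); split; first exact: continuous_cyc.
  by apply: continuous_cyc; first exact: triple_swap.
- rewrite -at_inv; first exact: piece_inj.
  rewrite -lift_inv; case: ins => [<-|/in_map_iff [q [<- _]]].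
    split; apply: continuous_at; exact: finitary_flip.
  rewrite -act_inv; split; apply: continuous_at; exact: finitary_act.
Qed.

Lemma open_letter p : openX (fun x => fst x = p).
Proof. by move=> q x e; exists 0, []. Qed.

Lemma open_bit i c : openX (fun x => fst (snd x) i = c).
Proof. by move=> q x e; exists (S i), [] => y [a1 _]; rewrite /= -a1 //; lia. Qed.

Lemma open_coord q c : openX (fun x => snd (snd x) q = c).
Proof. by move=> p x e; exists 0, [q] => y [_ a2]; rewrite /= -a2 //; left. Qed.

(** The Hausdorff property: distinct points differ in the letter, in a bit or in a coordinate. *)
Lemma separated (x x' : X) : x <> x' -> exists U U', openX U /\ openX U' /\ U x /\ U' x' /\
  forall z, U z -> U' z -> False.
Proof.
case: x x' => p [z y] [p' [z' y']] ne.
case: (classic (p = p')) => [ep|np]; last first.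
  exists (fun x => fst x = p), (fun x => fst x = p').
  by do 4?[split=> //]; try exact: open_letter; move=> x -> /np.
case: (classic (exists i, z i <> z' i)) => [[i ni]|nz].
  exists (fun x => fst (snd x) i = z i), (fun x => fst (snd x) i = z' i).
  by do 4?[split=> //]; try exact: open_bit; move=> x -> /ni.
case: (classic (exists q, y q <> y' q)) => [[q nq]|ny].
  exists (fun x => snd (snd x) q = y q), (fun x => snd (snd x) q = y' q).
  by do 4?[split=> //]; try exact: open_coord; move=> x -> /nq.
case: ne; rewrite ep; congr pair; congr pair; apply: functional_extensionality => i; apply: NNPP => n.
  by apply: nz; exists i.
by apply: ny; exists i.
Qed.

Lemma prefix m (x : D) : exists w x', length w = m /\ prepend w x' = x.
Proof.
elim: m x => [|m IH] x; first by exists [], x.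
have [i [y ->]] := split_stream x; have [w [x' [lw <-]]] := IH y.
by exists (i :: w), x'; rewrite /= lw.
Qed.

Lemma prepend_snd w (x : D) : snd (prepend w x) = snd x.
Proof. by elim: w. Qed.

(** Take a point x moved by n and disjoint open sets around x and n x. By continuity a basic
    neighbourhood of x lies in the first set and is sent into the second; such a neighbourhood is a
    word times a cylinder. *)
Lemma displaced_brick n : K n -> n <> gone -> exists p w F y0, p < letters /\
  forall x y, cyl F y0 (snd x) = true -> cyl F y0 (snd y) = true ->
    (n : perm X) (piece p w x) <> piece p w y.
Proof.
move=> Kn ne.
have [[p x0] nx] : exists x, (n : perm X) x <> x.
  apply: NNPP => no; apply: ne; apply: perm_ext => x; apply: NNPP => nx.
  by apply: no; exists x.
have pd : p < letters.
  by case: (Nat.lt_ge_cases p letters) => // /(K_large x0 Kn) /nx.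
have [U' [U [oU' [oU [Ux' [Ux dis]]]]]] := separated nx.
have [m [F H]] := nbhd_and (oU _ _ Ux) (K_continuous Kn oU' Ux').
have [w [x1 [lw e]]] := prefix m x0.
exists p, w, F, (snd x0); split=> // x y cx cy E.
have ag z : cyl F (snd x0) (snd z) = true -> agree m F x0 (prepend w z).
  move=> /cylP cz; split=> [i|q qF]; last by rewrite prepend_snd cz.
  have : agree (length w + 0) [] (prepend w x1) (prepend w z) by apply: agree_prepend; split=> // j; lia.
  by rewrite e Nat.add_0_r lw => -[a1 _]; exact: a1.
have [_ nU'] := H _ (ag x cx); have [UU _] := H _ (ag y cy).
by apply: (dis (piece p w y)) => //; rewrite -E.
Qed.

Lemma K_normal_all N : is_subgroup N -> normalized_by K N -> forall n, K n -> N n -> n <> gone ->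
  forall f, K f -> N f.
Proof.
move=> sN nN n Kn Nn ne.
have [p [w [F [y0 [pd disp]]]]] := displaced_brick Kn ne.
have Nc := N_of_displaced sN nN Nn pd (allows_cyl F y0) disp.
have := N_cyl_full sN nN Nc; apply: (N_everything sN nN) => //; apply: lt_letters; lia.
Qed.

Lemma K_nontrivial : exists f, K f /\ f <> gone.
Proof.
exists (c3 0 1 2 full); split; first exact: K_c3_012.
move=> /(f_equal (fun f : Sym X => (f : perm X) (0, (fun _ => true, fun _ => true)))).
by rewrite c3_1.
Qed.

End Configurations.

(** * Word metrics and the embedding *)

Section SubgroupAsGroup.
Variables (G : Group) (H : G -> Prop).
Hypothesis sH : is_subgroup H.

Lemma subgroup_ext (x y : {g : G | H g}) : proj1_sig x = proj1_sig y -> x = y.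
Proof.
case: x y => x Hx [y Hy] /= e; subst y; congr exist; exact: proof_irrelevance.
Qed.

Definition subgroup_group : Group.
Proof.
refine (@Build_Group {g : G | H g}
  (fun x y => exist H (proj1_sig x ** proj1_sig y) (subM sH (proj2_sig x) (proj2_sig y)))
  (exist H gone (sub1 sH))
  (fun x => exist H (proj1_sig x)^-1 (subV sH (proj2_sig x))) _ _ _ _ _).
- by move=> x y z; apply: subgroup_ext; exact: gmul_assoc.
- by move=> x; apply: subgroup_ext; exact: gmul_one_l.
- by move=> x; apply: subgroup_ext; exact: gmul_one_r.
- by move=> x; apply: subgroup_ext; exact: gmul_inv_l.
- by move=> x; apply: subgroup_ext; exact: gmul_inv_r.
Defined.

End SubgroupAsGroup.

Definition prod_group (G H : Group) : Group.
Proof.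
refine (@Build_Group (G * H)%type
  (fun x y => (fst x ** fst y, snd x ** snd y)) (gone, gone)
  (fun x => ((fst x)^-1, (snd x)^-1)) _ _ _ _ _).
- by move=> [x x'] [y y'] [z z'] /=; rewrite !gmul_assoc.
- by move=> [x x'] /=; rewrite !gmul_one_l.
- by move=> [x x'] /=; rewrite !gmul_one_r.
- by move=> [x x'] /=; rewrite !gmul_inv_l.
- by move=> [x x'] /=; rewrite !gmul_inv_r.
Defined.

Definition Zgroup : Group.
Proof.
refine (@Build_Group Z Z.add 0%Z Z.opp _ _ _ _ _); lia.
Defined.

Section Words.
Variable G : Group.
Implicit Types (S : list G) (w : list (bool * G)).

(** A bound on the word length in place of its exact value: it passes through products, inverses and
    homomorphisms without minimal words. *)
Definition short S n (g : G) := exists w, word_over S w /\ word_eval w = g /\ length w <= n.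

Lemma word_eval_app w w' : word_eval (w ++ w') = word_eval w ** word_eval w' :> G.
Proof. by elim: w => [|l w IH] /=; rewrite ?gmul_one_l // IH gmul_assoc. Qed.

Lemma short_one S : short S 0 gone.
Proof. by exists []; split; [move=> l; case|split]. Qed.

Lemma short_mul S m n g h : short S m g -> short S n h -> short S (m + n) (g ** h).
Proof.
move=> [w [ow [<- lw]]] [w' [ow' [<- lw']]]; exists (w ++ w'); rewrite word_eval_app length_app.
split; last by split=> //; lia.
by move=> l il; case: (in_app_or _ _ _ il) => il'; [exact: ow|exact: ow'].
Qed.

Lemma short_weaken S m n g : m <= n -> short S m g -> short S n g.
Proof. by move=> le [w [ow [e lw]]]; exists w; do 2?split=> //; lia. Qed.

Lemma letter_inv (l : bool * G) : letter_val (negb (fst l), snd l) = (letter_val l)^-1.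
Proof. by case: l => -[] g; rewrite /letter_val //= ginvK. Qed.

Lemma short_inv S n g : short S n g -> short S n g^-1.
Proof.
move=> [w [ow [<- lw]]]; apply: (short_weaken lw) => {lw}.
elim: w ow => [|l w IH] ow /=; first by rewrite ginv1; exact: short_one.
rewrite ginv_mul -Nat.add_1_r; apply: short_mul.
  by apply: IH => l' il; apply: ow; right.
exists [(negb (fst l), snd l)]; split; first by move=> l' [<-|[]]; apply: (ow l); left.
by rewrite /= letter_inv gmul_one_r.
Qed.

Lemma short_gen S g : In g S -> short S 1 g.
Proof.
move=> gS; exists [(true, g)]; split; first by move=> l [<-|[]].
by rewrite /= /letter_val /= gmul_one_r.
Qed.

Lemma words_subgroup S : is_subgroup (fun g => exists n, short S n g).
Proof.
split; first by exists 0; exact: short_one.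
- by move=> g h [m Hm] [n Hn]; exists (m + n); exact: short_mul.
- by move=> g [n Hn]; exists n; exact: short_inv.
Qed.

Lemma generates_short S : generates S -> forall g, exists n, short S n g.
Proof. by move=> gS g; have [w [ow e]] := gS g; exists (length w), w. Qed.

Lemma generates_of_short S : (forall g, exists n, short S n g) -> generates S.
Proof. by move=> H g; have [n [w [ow [e _]]]] := H g; exists w. Qed.

Lemma generates_generated S : generates S -> forall g, generated (fun s => In s S) g.
Proof.
move=> gS g; have [w [ow <-]] := gS g; elim: w ow => [|[c s] w IH] ow /=; first exact: gen_one.
apply: gen_mul; last by apply: IH => l il; apply: ow; right.
have Hs : In s S by apply: (ow (c, s)); left.
by case: c {ow}; rewrite /letter_val /=; [|apply: gen_inv]; exact: gen_base.
Qed.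

End Words.

Lemma hom_one (G H : Group) (f : G -> H) : is_hom f -> f gone = gone.
Proof.
by move=> hf; apply: (@gmulI _ (f gone)); rewrite -hf !gmul_one_r.
Qed.

Lemma hom_inv (G H : Group) (f : G -> H) g : is_hom f -> f (g^-1) = (f g)^-1.
Proof. by move=> hf; apply: ginv_uniq; rewrite -hf gmul_inv_r hom_one. Qed.

Lemma short_hom (G H : Group) (f : G -> H) S T C : is_hom f ->
  (forall s, In s S -> short T C (f s)) -> forall n g, short S n g -> short T (C * n) (f g).
Proof.
move=> hf HS n g [w [ow [<- lw]]].
apply: (@short_weaken _ _ (C * length w)); first by apply: Nat.mul_le_mono_l.
elim: w ow {lw} => [|[c s] w IH] ow; cbn [word_eval length].
  by rewrite hom_one // Nat.mul_0_r; exact: short_one.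
rewrite hf Nat.mul_succ_r Nat.add_comm; apply: short_mul; last first.
  by apply: IH => l il; apply: ow; right.
have Hs : short T C (f s) by apply: HS; apply: (ow (c, s)); left.
by case: c {ow}; rewrite /letter_val /= ?hom_inv //; exact: short_inv.
Qed.

Lemma uniform_bound (I : Type) (P : nat -> I -> Prop) (l : list I) :
  (forall m n i, m <= n -> P m i -> P n i) -> (forall i, In i l -> exists n, P n i) ->
  exists n, forall i, In i l -> P n i.
Proof.
move=> mono; elim: l => [|i l IH] H; first by exists 0.
have [n Hn] := H i (or_introl eq_refl).
have [m Hm] := IH (fun j jl => H j (or_intror jl)).
exists (n + m) => j [<-|jl]; [apply: (mono n) => //; lia|apply: (mono m); [lia|exact: Hm]].
Qed.

(** * Translations up to finitely many coordinates *)

Section Follows.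
Variable Q : Group.

Definition follows (q : Q) (y y' : Y Q) := exists F : list Q, forall r, ~ In r F -> y' r = act q y r.

(** The exceptional set of the first step is translated by q and joined to that of the second. *)
Lemma follows_mul p q y y' y'' : follows p y y' -> follows q y' y'' -> follows (q ** p) y y''.
Proof.
move=> [F HF] [F' HF']; exists (F' ++ map (fun r => q ** r) F) => r nr.
rewrite act_mul HF'; first by move=> rF; apply: nr; apply: in_or_app; left.
apply: HF => rF; apply: nr; apply: in_or_app; right.
apply/in_map_iff; exists (q^-1 ** r); split=> //.
by rewrite gmul_assoc gmul_inv_r gmul_one_l.
Qed.

Lemma follows_inv q y y' : follows q y y' -> follows (q^-1) y' y.
Proof.
move=> [F HF]; exists (map (fun r => q^-1 ** r) F) => r nr.
rewrite /= ginvK HF.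
  move=> rF; apply: nr; apply/in_map_iff; exists (q ** r); split=> //.
  by rewrite gmul_assoc gmul_inv_l gmul_one_l.
by rewrite /= gmul_assoc gmul_inv_l gmul_one_l.
Qed.

Lemma follows_one y : follows gone y y.
Proof. by exists [] => r _; rewrite act_one. Qed.

End Follows.

(** * The embedding and its undistortedness *)

Section Embedding.
Variables (G : Group) (S : list G).
Hypothesis gS : generates S.

(* The factor Z gives every g in G infinitely many coordinates (g, j), so that flipping finitely many of them
   cannot hide a translation by G, even when G is finite. *)
Definition Q : Group := prod_group G Zgroup.
Definition SQ : list Q := (gone, 1%Z) :: map (fun s => (s, 0%Z)) S.

Lemma gSQ : forall q, generated (fun s => In s SQ) q.
Proof.
have gen1 g : generated (fun s => In s SQ) ((g, 0%Z) : Q).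
{ elim: (generates_generated gS g) => {g} [s Hs||g h _ IHg _ IHh|g _ IH].
  - by apply: gen_base; right; apply/in_map_iff; exists s.
  - exact: gen_one.
  - by have := gen_mul IHg IHh.
  - by have := gen_inv IH. }
have gen2 z : generated (fun s => In s SQ) ((gone, z) : Q).
  have pos n : generated (fun s => In s SQ) ((gone, Z.of_nat n) : Q).
    elim: n => [|n IH]; first exact: gen_one.
    have b1 : generated (fun s => In s SQ) ((gone, 1%Z) : Q) by apply: gen_base; left.
    have := gen_mul IH b1; rewrite /= gmul_one_l.
    by have -> : (Z.of_nat n + 1)%Z = Z.of_nat (Datatypes.S n) by lia.
  case: (Z_le_gt_dec 0 z) => le; first by rewrite -(Z2Nat.id z).
  have := gen_inv (pos (Z.to_nat (- z))); rewrite /= ginv1.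
  by have -> : (- Z.of_nat (Z.to_nat (- z)))%Z = z by lia.
move=> [g z]; have := gen_mul (gen1 g) (gen2 z).
by rewrite /= gmul_one_r.
Qed.

Notation Y := (Y Q).
Notation K := (K (@A0 Q) (gens SQ)).
Notation X := (X Y).
Notation letters := (letters (gens SQ)).
Notation piece := (@piece Y).

Definition KG : Group := subgroup_group (@K_subgroup Y (@A0 Q) (gens SQ)).

Lemma KG_simple : simple_group KG.
Proof.
split.
  have [f [Kf ne]] := K_nontrivial SQ.
  by exists (exist _ f Kf) => /(f_equal (@proj1_sig _ _)).
move=> N [N1 [NM [NV NJ]]].
case: (classic (exists x, N x /\ x <> gone)) => [[[n Kn] [Nn ne]]|none]; last first.
  left=> x; split=> [Nx|-> //]; apply: NNPP => ne; apply: none; by exists x.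
right=> -[f Kf].
(* N lives on the subset type of [KG]; it is transported to a predicate on permutations to apply
   [K_normal_all]. *)
pose N' (f : Sym X) := exists Kf : K f, N (exist _ f Kf).
have pi f' Kf1 Kf2 : N (exist K f' Kf1) -> N (exist K f' Kf2).
  by have -> : Kf1 = Kf2 by exact: proof_irrelevance.
have sN : is_subgroup N'.
{ split; first by exists (sub1 (@K_subgroup _ _ _)).
  - by move=> x y [Kx Nx] [Ky Ny]; eexists; exact: NM _ _ Nx Ny.
  - by move=> x [Kx Nx]; eexists; exact: NV _ Nx. }
have nN : normalized_by K N'.
  (* [normal_subgroup] conjugates as g^-1 x g, hence the inverse of h. *)
  move=> h x Kh [Kx Nx]; have := NJ (exist _ (h^-1) (subV (@K_subgroup _ _ _) Kh)) _ Nx.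
  move=> Nc; exists (K_normalized Kh Kx); move: Nc; congr N.
  by apply: subgroup_ext; rewrite /= -[in RHS](ginvK h).
have ne' : n <> gone by move=> e; apply: ne; exact: subgroup_ext.
have [Kf' Nf] : N' f.
  by apply: (K_normal_all gSQ sN nN Kn _ ne' Kf); exists Kn.
exact: pi Nf.
Qed.

Definition aK : KG := exist _ (gen_a (@A0 Q) (gens SQ)) (gen_a_in_K _ _).
Definition bK : KG := exist _ (gen_b (gens SQ)) (gen_b_in_K _ _).

Lemma KG_two_generated : generates [aK; bK].
Proof.
apply: generates_of_short => -[f Kf].
have W := words_subgroup [aK; bK].
pose P (f : Sym X) := exists Kf : K f, exists n, short [aK; bK] n (exist K f Kf : KG).
suff : P f by move=> [Kf' H]; have -> : Kf = Kf' by exact: proof_irrelevance.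
have sP : is_subgroup P.
{ split.
  - by exists (sub1 (@K_subgroup _ _ _)); exact: (sub1 W).
  - by move=> x y [Kx Wx] [Ky Wy]; eexists; exact: (subM W Wx Wy).
  - by move=> x [Kx Wx]; eexists; exact: (subV W Wx). }
apply: (generated_min sP _ Kf) => g [->|->].
  by exists (gen_a_in_K _ _), 1; apply: short_gen; left.
by exists (gen_b_in_K _ _), 1; apply: short_gen; right; left.
Qed.

Definition embed_perm (g : G) : Sym X := at_piece (piece 0 []) (lift (act ((g, 0%Z) : Q))).

Lemma embed_K g : K (embed_perm g).
Proof. by apply: (spreads_act gSQ); apply: lt_letters; lia. Qed.

Definition embed (g : G) : KG := exist _ (embed_perm g) (embed_K g).

Lemma embed_hom : is_hom embed.
Proof.
move=> g h; apply: subgroup_ext; rewrite /= /embed_perm.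
have -> : act ((g ** h, 0%Z) : Q) = perm_mul (act ((g, 0%Z) : Q)) (act ((h, 0%Z) : Q)).
  exact: (act_mul ((g, 0%Z) : Q) ((h, 0%Z) : Q)).
by rewrite lift_mul at_mul //; exact: piece_inj.
Qed.

(** The translation q may vary with the point; only its G-part is measured, since its Z-part is
    irrelevant to the distance in G. The bound is subadditive under products. *)
Definition displacement n (f : Sym X) := forall x, exists q : Q, short S n (fst q) /\
  follows q (snd (snd x)) (snd (snd ((f : perm X) x))).

Lemma displacement_one : displacement 0 gone.
Proof. by move=> x; exists gone; split; [exact: short_one|exact: follows_one]. Qed.

Lemma displacement_weaken m n f : m <= n -> displacement m f -> displacement n f.
Proof. by move=> le H x; have [q [sq fq]] := H x; exists q; split=> //; exact: short_weaken sq. Qed.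

Lemma displacement_mul m n f g : displacement m f -> displacement n g -> displacement (m + n) (f ** g).
Proof.
move=> Hf Hg x; have [q [sq fq]] := Hg x; have [p [sp fp]] := Hf ((g : perm X) x).
by exists (p ** q); split; [exact: short_mul|exact: follows_mul fq fp].
Qed.

Lemma displacement_inv n f : displacement n f -> displacement n (f^-1).
Proof.
move=> Hf x; have [q [sq fq]] := Hf ((f^-1 : perm X) x).
exists (q^-1); split; first exact: short_inv.
by move: (follows_inv fq); rewrite /= bwdK.
Qed.

Lemma cyc_snd p q r u v w A x : triple (piece p u) (piece q v) (piece r w) ->
  snd (snd ((cyc (piece p u) (piece q v) (piece r w) (on A) : perm X) x)) = snd (snd x).
Proof.
move=> t; have sE s z (y : D Y) : snd (snd (piece s z y)) = snd y by exact: prepend_snd.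
case: (classic (exists y, piece p u y = x)) => [[y <-]|n1].
  by rewrite cyc1 //; case: (on A y); rewrite !sE.
case: (classic (exists y, piece q v y = x)) => [[y <-]|n2].
  by rewrite cyc2 //; case: (on A y); rewrite !sE.
case: (classic (exists y, piece r w y = x)) => [[y <-]|n3].
  by rewrite cyc3 //; case: (on A y); rewrite !sE.
by rewrite cyc0 // => y E; [case: n1|case: n2|case: n3]; exists y.
Qed.

(** 3-cycles leave the configuration unchanged, a flip alters one coordinate, and each generator in
    [SQ] has a G-part of length at most 1. *)
Lemma K_displacement f : K f -> exists n, displacement n f.
Proof.
move: f; apply: (K_min (P := fun f => exists n, displacement n f))
  => [|p q r v w u A pd qd rd pq qr rp _|p s pd ins].
- split; first by exists 0; exact: displacement_one.
  + by move=> f g [m Hm] [n Hn]; exists (m + n); exact: displacement_mul.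
  + by move=> f [n Hn]; exists n; exact: displacement_inv.
- exists 0 => x; exists gone; split; first exact: short_one.
  by rewrite cyc_snd; [exact: (@piece_triple Y)|exact: follows_one].
- exists 1 => -[r x]; case: (classic (r = p)) => [->|n]; last first.
    rewrite supported_at //; exists gone.
    by split; [apply: short_weaken (short_one S); lia|exact: follows_one].
  have -> : (at_piece (piece p []) (lift s) : perm X) (p, x) = (p, lift s x).
    exact: (atE (lift s) (@piece_inj Y p []) x).
  have {ins} [<-|ins] : flip gone = s \/ In s (map (@act Q) SQ) := ins.
    exists gone; split; first by apply: short_weaken (short_one S); lia.
    exists [gone] => t nt; rewrite act_one /= /flip_fun.
    by case: excluded_middle_informative => // e; case: nt; left.
  have [q [<- inq]] := proj1 (in_map_iff _ _ _) ins.
  exists q; split; last by exists [].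
  have {inq} [<-|inq] : ((gone, 1%Z) : Q) = q \/ In q (map (fun s => (s, 0%Z)) S) := inq.
    by apply: short_weaken (short_one S); lia.
  by have [g [<- gin]] := proj1 (in_map_iff _ _ _) inq; exact: short_gen.
Qed.

(** The test configuration y is the indicator of {1} x Z. Its translate by g is the indicator of {g}
    x Z, an infinite set, so some (g, j) escapes F and detects the G-part of q. *)
Lemma act_eq_fst (g : G) (F : list Q) (q : Q) :
  let y : Y := fun r => match excluded_middle_informative (fst r = gone) with left _ => true | right _ => false end in
  (forall r, ~ In r F -> act ((g, 0%Z) : Q) y r = act q y r) -> fst q = g.
Proof.
move=> y H.
have [j Hj] : exists j : Z, ~ In ((g, j) : Q) F.
  have [j Hj] : exists j : Z, forall r, In r F -> (snd r < j)%Z.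
    elim: F {H} => [|r F [j Hj]]; first by exists 0%Z.
    by exists (Z.max j (snd r + 1)) => r' [<-|/Hj]; lia.
  by exists j => /Hj /=; lia.
have := H _ Hj; rewrite /= /y.
case: excluded_middle_informative => [_|[]] /=; last by rewrite gmul_inv_l.
case: excluded_middle_informative => [/= e _|//].
by apply: (@gmulI _ (fst q)^-1); rewrite gmul_inv_l e.
Qed.

Lemma embed_displacement n g : displacement n (embed_perm g) -> short S n g.
Proof.
pose y : Y := fun r => match excluded_middle_informative (fst r = gone) with left _ => true | right _ => false end.
move=> /(_ (0, (fun _ => true, y))) [q [sq [F HF]]].
suff <- : fst q = g by [].
apply: (@act_eq_fst g F q) => r nr; rewrite -(HF r nr).
have -> // : (embed_perm g : perm X) (0, (fun _ => true, y)) = (0, (fun _ => true, act ((g, 0%Z) : Q) y)).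
exact: (atE (lift (act ((g, 0%Z) : Q))) (@piece_inj Y 0 []) (fun _ => true, y)).
Qed.

Lemma embed_inj : injective embed.
Proof.
move=> g h /(f_equal (@proj1_sig _ _)) /= e.
pose y : Y := fun r => match excluded_middle_informative (fst r = gone) with left _ => true | right _ => false end.
symmetry; apply: (@act_eq_fst g [] ((h, 0%Z) : Q)) => r _.
have ev k : (embed_perm k : perm X) (0, (fun _ => true, y)) = (0, (fun _ => true, act ((k, 0%Z) : Q) y)).
  exact: (atE (lift (act ((k, 0%Z) : Q))) (@piece_inj Y 0 []) (fun _ => true, y)).
have := ev g; rewrite e ev => /(f_equal (fun x : X => snd (snd x) r)) E.
exact: eq_sym E.
Qed.

(** C bounds the displacement of every element of T. A word of length n over T has displacement at
    most C * n, and for [embed g] this bounds the length of g. *)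
Lemma lower_bound (T : list KG) : exists C, forall n g, short T n (embed g) -> short S (C * n) g.
Proof.
have [C HC] : exists C, forall t, In t T -> displacement C (proj1_sig t).
  apply: (uniform_bound (P := fun n (t : KG) => displacement n (proj1_sig t))).
    by move=> m n t; exact: displacement_weaken.
  by move=> [t Kt] _; exact: K_displacement.
exists C => n g [w [ow [ew lw]]]; apply: embed_displacement.
have -> : embed_perm g = proj1_sig (word_eval w) by rewrite ew.
apply: (@displacement_weaken (C * length w)); first exact: Nat.mul_le_mono_l.
elim: w ow {ew lw} => [|[c t] w IH] ow; cbn [length].
  by rewrite Nat.mul_0_r; exact: displacement_one.
have -> : proj1_sig (word_eval ((c, t) :: w)) =
  proj1_sig (letter_val (c, t)) ** proj1_sig (word_eval w) :> Sym X by [].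
rewrite Nat.mul_succ_r Nat.add_comm; apply: displacement_mul; last first.
  by apply: IH => l il; apply: ow; right.
have Ht : displacement C (proj1_sig t) by apply: HC; apply: (ow (c, t)); left.
by case: c {ow}; [exact: Ht|exact: displacement_inv Ht].
Qed.

(** A homomorphism is Lipschitz: C bounds the T-lengths of the images of the finitely many elements
    of S. *)
Lemma upper_bound (T : list KG) : generates T ->
  exists C, forall n g, short S n g -> short T (C * n) (embed g).
Proof.
move=> gT.
have [C HC] : exists C, forall s, In s S -> short T C (embed s).
  apply: (uniform_bound (P := fun n s => short T n (embed s))).
    by move=> m n s; exact: short_weaken.
  by move=> s _; exact: generates_short.
by exists C => n g; apply: short_hom => //; exact: embed_hom.
Qed.

Lemma embed_qi (T : list KG) : generates T -> qi_embedding S T embed.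
Proof.
move=> gT; have [C1 H1] := lower_bound T; have [C2 H2] := upper_bound gT.
(* The sum dominates both Lipschitz constants and the added 1 makes it positive. The estimates are
   purely multiplicative, so D = 1 serves for positivity. *)
exists (INR (C1 + C2 + 1)), 1%R.
have Cpos : (0 < INR (C1 + C2 + 1))%R by apply: lt_0_INR; lia.
split=> //; split; first lra.
move=> x y m n [[w [ow [ew lw]]] mm] [[v [ov [ev lv]]] nn].
have E : (embed x)^-1 ** embed y = embed (x^-1 ** y) by rewrite embed_hom (hom_inv _ embed_hom).
have mn : m <= C1 * n.
  have [w' [ow' [ew' lw']]] : short S (C1 * n) (x^-1 ** y).
    by apply: H1; exists v; rewrite -E lv.
  by have := mm _ ow' ew'; lia.
have nm : n <= C2 * m.
  have [v' [ov' [ev' lv']]] : short T (C2 * m) (embed (x^-1 ** y)).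
    by apply: H2; exists w; rewrite lw.
  by rewrite -E in ev'; have := nn _ ov' ev'; lia.
split.
  suff : (/ INR (C1 + C2 + 1) * INR m <= INR n)%R by lra.
  apply: (Rmult_le_reg_l _ _ _ Cpos); rewrite -Rmult_assoc Rinv_r; first lra.
  by rewrite Rmult_1_l -mult_INR; apply: le_INR; nia.
suff : (INR n <= INR (C1 + C2 + 1) * INR m)%R by lra.
by rewrite -mult_INR; apply: le_INR; nia.
Qed.

End Embedding.

Theorem theoremC :
  forall (G : Group) (S : list G), generates S ->
  exists (K : Group) (a b : K) (f : G -> K),
    simple_group K /\ generates [a; b] /\
    is_hom f /\ injective f /\
    (forall T : list K, generates T -> qi_embedding S T f).
Proof.
move=> G S gS; exists (KG S), (aK S), (bK S), (embed gS); split; first exact: KG_simple.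
split; first exact: KG_two_generated.
split; first exact: embed_hom.
split; first exact: embed_inj.
by move=> T; exact: embed_qi.
Qed.
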